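(* Let $\mu$ be a probability measure on $\mathbb R$ and $\mu^n$ the $n$-fold product measure on $\mathbb R^n$. Let $H:\mathbb R\to[0,+\infty]$ be an even convex function. Assume that $x\mapsto H(x)/x^2$ is non-decreasing on $(0,+\infty)$. If there exists $\kappa\in(0,+\infty)$ such that every locally Lipschitz $f:\mathbb R\to\mathbb R$ satisfies $$\mathbf{Ent}_\mu(f^2)\le\kappa\int H\left(\frac{f'}{f}\right)f^2\,d\mu,$$ then every locally Lipschitz $F:\mathbb R^n\to\mathbb R$ with $\sum_{i=1}^nH(\partial_iF)\le a$ $\mu^n$-a.e. (where $a>0$) satisfies $$\mu^n\left(\left\{F-\mu^n(F)\ge r\right\}\right)\le e^{-K\omega_H^*\left(\frac{2r}{K}\right)}\qquad\forall r\ge0,$$ where $\omega_H^*$ is the conjugate of $\omega_H$ and $K=a\kappa$.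
   Context: For $x\ge0$, $\omega_H(x)=\sup_{t>0}\frac{H(tx)}{H(t)}\in[0,+\infty]$, with $\omega_H(0)=0$ (conventions: $0/0=0$, $c/0=+\infty$ for $c>0$, and values $t$ with $H(t)=+\infty$ are omitted from the supremum); $\omega_H^*(y)=\sup_{x\ge0}\{xy-\omega_H(x)\}$ for $y\ge0$. $\mu^n(F)=\int F\,d\mu^n$; that $F$ is $\mu^n$-integrable is part of the assertion. $\mathbf{Ent}_\mu(g)=\int g\log g\,d\mu-(\int g\,d\mu)\log(\int g\,d\mu)$. For a locally Lipschitz $f$ on $\mathbb R$, $|f'|(x)=\lim_{r\to0^+}\sup_{|x-y|\le r}\frac{|f(x)-f(y)|}{|x-y|}$, which is the absolute value of the usual derivative wherever $f$ is differentiable; $|\partial_iF|$ is the same quantity applied to $F$ as a function of its $i$-th coordinate. Only absolute values matter since $H$ is even. The integrand $H(f'/f)f^2$ is read as $0$ at points where $f=0$.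
   Formalization: H(0)=0 is assumed; it follows from the other hypotheses unless H is +∞ at every nonzero point, and for such H with 0<H(0)<+∞ the claim can fail (e.g. the uniform measure on {0,1}). *)

(* Defs.v *)
From HB Require Import structures.
From mathcomp Require Import all_boot all_order all_algebra.
From mathcomp Require Import all_classical all_reals all_analysis.

Set Implicit Arguments.
Unset Strict Implicit.
Unset Printing Implicit Defensive.

Import Order.TTheory GRing.Theory Num.Theory.
Import numFieldNormedType.Exports.

Local Open Scope classical_set_scope.
Local Open Scope ring_scope.

Section product_power.
Context (d : measure_display) (T : measurableType d) (R : realType).
Variable mu : probability T R.

Definition tuple_cons (n : nat) (p : T * n.-tuple T) : n.+1.-tuple T :=
  [tuple of p.1 :: p.2].

Lemma measurable_tuple_cons (n : nat) :
  measurable_fun [set: T * n.-tuple T] (@tuple_cons n).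
Proof. exact: (measurable_cons measurable_fst measurable_snd). Qed.

HB.instance Definition _ (n : nat) :=
  isMeasurableFun.Build _ _ _ _ (@tuple_cons n) (@measurable_tuple_cons n).

(* mu ^ 0 is the unit mass of the empty tuple, and mu ^ (n + 1) is the image of
   the binary product measure mu \x mu ^ n under cons. *)
Fixpoint prob_power (n : nat) : probability (n.-tuple T) R :=
  match n return probability (n.-tuple T) R with
  | 0 => dirac [tuple]
  | m.+1 => distribution (mu \x prob_power m)%E (@tuple_cons m)
  end.

End product_power.

Section log_sobolev.
Context (R : realType).
Implicit Types (f : R -> R) (H : R -> \bar R).

(* The value y = x is left out of the supremum.  The supremum and the limit are
   taken in \bar R and are finite when f is locally Lipschitz. *)
Definition local_slope f (x : R) : R :=
  fine (lim ((ereal_sup [set (`|f x - f y| / `|x - y|)%:E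
                        | y in [set y | y != x /\ `|x - y| <= r]])
             @[r --> 0^'+])).

Definition tuple_set (n : nat) (x : n.-tuple R) (i : 'I_n) (t : R) :
    n.-tuple R :=
  [tuple if j == i then t else tnth x j | j < n].

Definition partial_slope (n : nat) (F : n.-tuple R -> R) (i : 'I_n)
    (x : n.-tuple R) : R :=
  local_slope (fun t => F (tuple_set x i t)) (tnth x i).

Definition loc_lipschitz f : Prop := [locally [lipschitz f x | x in [set: R]]].

Definition on_rows (n : nat) (F : n.-tuple R -> R) (v : 'rV[R]_n) : R :=
  F [tuple v ord0 i | i < n].

(* Tuples carry the product sigma-algebra but no norm; the Lipschitz condition
   is stated through row vectors, with the maximum norm. *)
Definition loc_lipschitz_tuple (n : nat) (F : n.-tuple R -> R) : Prop :=
  [locally [lipschitz (on_rows F) v | v in [set: 'rV[R]_n]]].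

(* Meaningful for g >= 0 integrable: since ln 0 = 0, 0 * -oo = 0 and g * ln g is
   bounded below, the value is then an unambiguous element of ]-oo, +oo]. *)
Definition entropy (d : measure_display) (T : measurableType d)
    (mu : {measure set T -> \bar R}) (g : T -> R) : \bar R :=
  (\int[mu]_x (g x * ln (g x))%:E
   - (\int[mu]_x (g x)%:E) * lne (\int[mu]_x (g x)%:E))%E.

(* The integrand H(f'/f) f^2; H is applied to |f'|/f, and is even in the uses
   of this definition. *)
Definition energy_density H f (x : R) : \bar R :=
  if f x == 0 then 0%E else (H (local_slope f x / f x)%R * (f x ^+ 2)%:E)%E.

(* Only f with f^2 integrable are tested, Ent(f^2) being undefined otherwise. *)
Definition log_sobolev_ineq (mu : probability (measurableTypeR R) R) H
    (kappa : R) : Prop :=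
  forall f, loc_lipschitz f ->
    mu.-integrable [set: R] (fun x => (f x ^+ 2)%:E) ->
    (entropy mu (fun x => f x ^+ 2)%R
       <= kappa%:E * \int[mu]_x energy_density H f x)%E.

Definition even_fun H : Prop := forall x, H (- x) = H x.

Definition convex_ereal H : Prop := forall (t x y : R), 0 <= t <= 1 ->
  (H (t * x + (1 - t) * y)%R <= t%:E * H x + (1 - t)%:E * H y)%E.

(* With 0^-1 = +oo and 0 * +oo = 0 in \bar R, the quotient satisfies 0 / 0 = 0
   and c / 0 = +oo for c > 0.  The maximum with 0 makes the supremum one in
   [0, +oo]: it only matters for the empty family, whose supremum is 0. *)
Definition omega H (x : R) : \bar R :=
  if x == 0 then 0%E else
  maxe 0%E (ereal_sup [set (H (t * x)%R / H t)%E
                      | t in [set t | 0 < t /\ (H t < +oo)%E]]).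

Definition omega_conj H (y : R) : \bar R :=
  ereal_sup [set ((x * y)%:E - omega H x)%E | x in [set x | 0 <= x]].

End log_sobolev.

(* Main.v *)
(* Herbst's argument.  Entropy tensorizes, so the logarithmic Sobolev inequality
   applied in each coordinate to [exp (s F / 2)] gives
     [Ent (exp (s F)) <= K (s / (2 x))^2 omega_H(x) E[exp (s F)]] for [s <= 2 x],
   because the monotonicity of [H(x) / x^2] yields
     [H(s t) <= (s / x)^2 omega_H(x) H(t)] for [s <= x].
   Integrating in [s] bounds [E[exp (2 x (F - E F))]] by [exp (K omega_H(x))], and
   Markov's inequality followed by optimization over [x] concludes.
   The argument is run on the truncations of [F] at [-N] and [N].  Since
   [omega_H(1) <= 1], the bound at [x = 1], for [F] and for [-F], makes the
   truncations bounded in [L^1], whence the integrability of [F]. *)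

Require Import Defs.
From HB Require Import structures.
From mathcomp Require Import all_boot all_order all_algebra.
From mathcomp Require Import all_classical all_reals all_analysis.
From mathcomp Require Import measurable_realfun.
From mathcomp Require Import ring lra.

Set Implicit Arguments.
Unset Strict Implicit.
Unset Printing Implicit Defensive.

Import Order.TTheory GRing.Theory Num.Theory.
Import numFieldNormedType.Exports.

Local Open Scope classical_set_scope.
Local Open Scope ring_scope.

(** * Entropy on a probability space *)

Section bounded.
Context d (T : measurableType d) (R : realType) (P : probability T R).
Implicit Types f g h : T -> R.

(** The bound [F_grad] holds only almost everywhere for the product measure, so it may fail
    throughout a given line parallel to an axis. The one-dimensional inequality is therefore applied
    on every line with [H] of the slope kept in the energy; the constant [a] enters only after
    tensorization, under the integral over the whole product. Since [H] may be infinite, the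
    energies live in [\bar R], whereas every entropy is a real number: truncation keeps the
    exponentials between two positive constants. Truncation is also 1-Lipschitz, so it does not
    increase slopes and the bound on the gradient of [F] serves all truncations. Integrating the
    energies over lines and over the product requires measurable partial slopes, although a slope is
    an infimum of uncountable suprema; this is why slopes are characterized through rational
    increments. *)

Lemma bounded_integrable f (M : R) : measurable_fun [set: T] f ->
  (forall x, `|f x| <= M) -> P.-integrable [set: T] (EFin \o f).
Proof.
move=> mf fM; apply: measurable_bounded_integrable => //.
  by rewrite (le_lt_trans (probability_le1 P measurableT)) ?ltry.
exists M; split; first exact: num_real.
by move=> y My x _; exact: (le_trans (fM x) (ltW My)).
Qed.

Lemma Rintegral_bounded_EFin f (M : R) : measurable_fun [set: T] f ->
  (forall x, `|f x| <= M) ->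
  (\int[P]_x (f x)%:E = (\int[P]_x f x)%:E)%E.
Proof.
move=> mf fM; rewrite /Rintegral fineK//.
exact: (integrable_fin_num measurableT (bounded_integrable mf fM)).
Qed.

Lemma Rintegral_prob_cst (c : R) : \int[P]_(_ in [set: T]) c = c.
Proof.
rewrite Rintegral_cst// -[RHS]mulr1; congr (_ * _).
exact: (congr1 fine (probability_setT P)).
Qed.

Lemma Rintegral_itv f (c C : R) : measurable_fun [set: T] f ->
  (forall x, c <= f x <= C) -> c <= \int[P]_x f x <= C.
Proof.
move=> mf fc.
have fi : P.-integrable [set: T] (EFin \o f).
  apply: (@bounded_integrable _ (`|c| + `|C|)) => // x.
  have /andP[cf fC] := fc x.
  have := ler_norm C; have := ler_norm (- c); rewrite normrN => h1 h2.
  have := normr_ge0 c; have := normr_ge0 C => h3 h4.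
  by rewrite ler_norml; apply/andP; split; lra.
have ci k : P.-integrable [set: T] (EFin \o (fun=> k : R)).
  exact: (@bounded_integrable _ `|k|).
rewrite -(Rintegral_prob_cst c) -(Rintegral_prob_cst C).
by apply/andP; split; apply: le_Rintegral => // x _; have /andP[] := fc x.
Qed.

(** The positive part of [f] already lies below [G], and the negative part only lowers the integral.
    This compares the entropy of a section, whose sign need not be known, with an energy that may be
    infinite. *)
Lemma le_integral_nonneg f (G : T -> \bar R) :
  measurable_fun [set: T] f -> measurable_fun [set: T] G ->
  (forall x, (0 <= G x)%E) -> (forall x, ((f x)%:E <= G x)%E) ->
  (\int[P]_x (f x)%:E <= \int[P]_x G x)%E.
Proof.
move=> /measurable_EFinP mf mG G0 fG.
rewrite integralE (@le_trans _ _ (\int[P]_x (EFin \o f)^\+ x)%E)//.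
  by rewrite geeDl// oppe_le0; apply: integral_ge0 => x _; exact: funeneg_ge0.
apply: ge0_le_integral => //; first exact: measurable_funepos.
by move=> x _; rewrite funeposE ge_max fG G0.
Qed.
End bounded.

(** The entropy in real arithmetic; it is used for functions with values in some [[c, C]] with
    [0 < c], for which [entropyE] identifies it with [entropy]. *)
Definition real_entropy d (T : measurableType d) (R : realType)
    (P : probability T R) (g : T -> R) : R :=
  \int[P]_x (g x * ln (g x)) - (\int[P]_x g x) * ln (\int[P]_x g x).

Section entropy.
Context d (T : measurableType d) (R : realType) (P : probability T R).
Implicit Types f g h : T -> R.

Lemma norm_itv (c C x : R) : 0 < c -> c <= x <= C -> `|x| <= C.
Proof. by move=> c0 /andP[cx xC]; rewrite ger0_norm//; lra. Qed.

Lemma norm_ln_itv (c C x : R) : 0 < c -> c <= x <= C ->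
  `|ln x| <= `|ln c| + `|ln C|.
Proof.
move=> c0 /andP[cx xC].
have h1 : ln c <= ln x by rewrite ler_ln ?posrE//; lra.
have h2 : ln x <= ln C by rewrite ler_ln ?posrE//; lra.
have := ler_norm (ln C); have := ler_norm (- ln c); rewrite normrN => h3 h4.
have := normr_ge0 (ln c); have := normr_ge0 (ln C) => h5 h6.
by rewrite ler_norml; apply/andP; split; lra.
Qed.

Lemma normM_le (x y A B : R) : `|x| <= A -> `|y| <= B -> `|x * y| <= A * B.
Proof. by move=> xA yB; rewrite normrM ler_pM. Qed.

Lemma measurable_xlnx g : measurable_fun [set: T] g ->
  measurable_fun [set: T] (fun x => g x * ln (g x)).
Proof.
move=> mg; apply: measurable_funM => //.
by apply: measurableT_comp => //; exact: measurable_ln.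
Qed.

Lemma entropyE g (c C : R) : measurable_fun [set: T] g -> 0 < c ->
  (forall x, c <= g x <= C) -> entropy P g = (real_entropy P g)%:E.
Proof.
move=> mg c0 gc.
rewrite /entropy.
rewrite (@Rintegral_bounded_EFin _ _ _ P _ (C * (`|ln c| + `|ln C|)))//; last 2 first.
- exact: measurable_xlnx.
- by move=> x; apply: normM_le; [exact: norm_itv (gc x)|exact: norm_ln_itv (gc x)].
rewrite (@Rintegral_bounded_EFin _ _ _ P _ C)//; last first.
  by move=> x; exact: norm_itv (gc x).
rewrite /lne /real_entropy EFinB EFinM /=.
have /andP[h _] := Rintegral_itv P mg gc.
by rewrite lt_geF// (lt_le_trans c0).
Qed.

(* Young: [u h <= u ln u - u + e^h] for [u = g / m]. *)
Lemma mul_le_entropy (g m h : R) : 0 < g -> 0 < m ->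
  g * h <= g * ln g - g * ln m - g + m * expR h.
Proof.
move=> g0 m0.
have := expR_ge1Dx (h - ln (g / m)).
rewrite expRB lnK ?posrE ?divr_gt0// ln_div ?posrE// => H.
have /(ler_wpM2l (ltW g0)) : 1 + (h - (ln g - ln m)) <= expR h / (g / m) by [].
have -> : g * (expR h / (g / m)) = m * expR h.
  by field; rewrite !gt_eqF.
lra.
Qed.

(** One half of the variational formula for the entropy. It is the integral of the pointwise Young
    inequality with [m] the mean of [g]: the leftover [- m + m * \int expR h] is nonpositive. *)
Lemma real_entropy_ge g h (c C M : R) : measurable_fun [set: T] g ->
  measurable_fun [set: T] h -> 0 < c -> (forall x, c <= g x <= C) ->
  (forall x, `|h x| <= M) -> \int[P]_x expR (h x) <= 1 ->
  \int[P]_x (g x * h x) <= real_entropy P g.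
Proof.
move=> mg mh c0 gc hM h1.
have g0 x : 0 < g x by have /andP[/(lt_le_trans c0)] := gc x.
have /andP[/(lt_le_trans c0) m0 mC] := Rintegral_itv P mg gc.
rewrite /real_entropy; set m := \int[P]_x g x in m0 mC *.
have i1 : P.-integrable [set: T] (EFin \o g).
  by apply: (@bounded_integrable _ _ _ _ _ (C)) => // x; exact: norm_itv (gc x).
have i2 : P.-integrable [set: T] (EFin \o (fun x => g x * ln (g x))).
  apply: (@bounded_integrable _ _ _ _ _ (C * (`|ln c| + `|ln C|))) => //.
    exact: measurable_xlnx.
  by move=> x; apply: normM_le; [exact: norm_itv (gc x)|exact: norm_ln_itv (gc x)].
have i3 : P.-integrable [set: T] (EFin \o (fun x => expR (h x))).
  apply: (@bounded_integrable _ _ _ _ _ (expR M)) => //.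
    exact: measurableT_comp.
  move=> x; rewrite ger0_norm ?expR_ge0// ler_expR (le_trans _ (hM x))//.
  exact: ler_norm.
have i4 : P.-integrable [set: T] (EFin \o (fun x => g x * h x)).
  apply: (@bounded_integrable _ _ _ _ _ (C * M)); first exact: measurable_funM.
  by move=> x; apply: normM_le => //; exact: norm_itv (gc x).
have i5 : P.-integrable [set: T] (EFin \o (fun x => g x * (ln m + 1))).
  exact: (integrableZr measurableT (ln m + 1) i1).
have i6 : P.-integrable [set: T] (EFin \o (fun x => m * expR (h x))).
  exact: (integrableZl measurableT m i3).
have i7 : P.-integrable [set: T]
    (EFin \o (fun x => g x * ln (g x) - g x * (ln m + 1))).
  exact: (integrableB measurableT i2 i5).
apply: (@le_trans _ _
  (\int[P]_x (g x * ln (g x) - g x * (ln m + 1) + m * expR (h x)))).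
  apply: le_Rintegral => //; first exact: (integrableD measurableT i7 i6).
  by move=> x _; have := mul_le_entropy (h x) (g0 x) m0; lra.
rewrite RintegralD// RintegralB// RintegralZl// RintegralZr// -/m.
have : m * (\int[P]_x expR (h x)) <= m * 1 by rewrite ler_pM2l.
lra.
Qed.
End entropy.

(** * Tensorization of the entropy *)

Section product.
Context d1 d2 (T1 : measurableType d1) (T2 : measurableType d2) (R : realType).
Variables (P1 : probability T1 R) (P2 : probability T2 R).

Section bounded_Fubini.
Variables (F : T1 * T2 -> R) (M : R).
Hypotheses (mF : measurable_fun [set: T1 * T2] F) (FM : forall z, `|F z| <= M).

Let iF : (P1 \x P2)%E.-integrable [set: T1 * T2] (EFin \o F).
Proof. exact: bounded_integrable FM. Qed.

Let fubini_FE : fubini_F P2 (EFin \o F) = EFin \o (fun x => \int[P2]_y F (x, y)).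
Proof.
apply/funext => x; rewrite /fubini_F /=.
rewrite (@Rintegral_bounded_EFin _ _ _ P2 (fun y => F (x, y)) M)//.
exact: measurable_fun_pair2.
Qed.

Let fubini_GE : fubini_G P1 (EFin \o F) = EFin \o (fun y => \int[P1]_x F (x, y)).
Proof.
apply/funext => y; rewrite /fubini_G /=.
rewrite (@Rintegral_bounded_EFin _ _ _ P1 (fun x => F (x, y)) M)//.
exact: measurable_fun_pair1.
Qed.

Lemma measurable_Rintegral_snd :
  measurable_fun [set: T1] (fun x => \int[P2]_y F (x, y)).
Proof.
by apply/measurable_EFinP; rewrite -fubini_FE; exact: (measurable_fubini_F iF).
Qed.

Lemma measurable_Rintegral_fst :
  measurable_fun [set: T2] (fun y => \int[P1]_x F (x, y)).
Proof.
by apply/measurable_EFinP; rewrite -fubini_GE; exact: (measurable_fubini_G iF).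
Qed.

Lemma Rintegral_prod12 :
  \int[(P1 \x P2)%E]_z F z = \int[P1]_x \int[P2]_y F (x, y).
Proof.
have := integral12_prod_meas1 iF; rewrite fubini_FE => /(congr1 fine) /esym.
exact.
Qed.

Lemma Rintegral_prod21 :
  \int[(P1 \x P2)%E]_z F z = \int[P2]_y \int[P1]_x F (x, y).
Proof.
have := integral21_prod_meas1 iF; rewrite fubini_GE => /(congr1 fine) /esym.
exact.
Qed.

End bounded_Fubini.

(* The marginal entropy [Ent (int f dP1)] is the integral of [f h] for
   [h = ln (int f dP1 / int f)], so the entropic inequality applied to the
   sections [f (x, _)] bounds it. *)
Lemma real_entropy_prod (f : T1 * T2 -> R) (c C : R) (g1 g2 : T1 * T2 -> \bar R) :
  measurable_fun [set: T1 * T2] f -> 0 < c -> (forall z, c <= f z <= C) ->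
  measurable_fun [set: T1 * T2] g1 -> measurable_fun [set: T1 * T2] g2 ->
  (forall z, (0 <= g1 z)%E) -> (forall z, (0 <= g2 z)%E) ->
  (forall y, ((real_entropy P1 (fun x => f (x, y)))%:E
               <= \int[P1]_x g1 (x, y))%E) ->
  (forall x, ((real_entropy P2 (fun y => f (x, y)))%:E
               <= \int[P2]_y g2 (x, y))%E) ->
  ((real_entropy (P1 \x P2)%E f)%:E <= \int[(P1 \x P2)%E]_z (g1 z + g2 z))%E.
Proof.
move=> mf c0 fc mg1 mg2 g10 g20 ent1 ent2.
pose flnf := fun z => f z * ln (f z).
pose K := C * (`|ln c| + `|ln C|).
have mflnf : measurable_fun [set: T1 * T2] flnf by exact: measurable_xlnx.
have flnfK z : `|flnf z| <= K.
  by apply: normM_le; [exact: norm_itv (fc z)|exact: norm_ln_itv (fc z)].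
have fC z : `|f z| <= C by exact: norm_itv (fc z).
pose m y := \int[P1]_x f (x, y).
have mm : measurable_fun [set: T2] m by exact: measurable_Rintegral_fst fC.
have mc y : c <= m y <= C.
  by apply: Rintegral_itv => // ; exact: measurable_fun_pair1.
have mC y : `|m y| <= C by exact: norm_itv (mc y).
pose M := \int[P2]_y m y.
have fM : \int[(P1 \x P2)%E]_z f z = M by exact: Rintegral_prod21 fC.
have Mc : c <= M <= C by exact: Rintegral_itv.
pose h y := ln (m y) - ln M.
pose D := (`|ln c| + `|ln C|) + (`|ln c| + `|ln C|).
have mh : measurable_fun [set: T2] h.
  apply: measurable_funB => //.
  by apply: measurableT_comp => //; exact: measurable_ln.
have hD y : `|h y| <= D.
  rewrite /h /D (le_trans (ler_normB _ _))// lerD//.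
    exact: norm_ln_itv (mc y).
  exact: norm_ln_itv Mc.
have M0 : 0 < M by case/andP: Mc => ? _; exact: lt_le_trans c0 _.
(* [expR (h y)] is [m y / M], a density of mean 1, so the same [h] is admissible in
   [real_entropy_ge] for every section [f (x, _)]. *)
have h1 : \int[P2]_y expR (h y) <= 1.
  have -> : (fun y => expR (h y)) = (fun y => m y * M^-1).
    apply/funext => y; rewrite /h expRB !lnK ?posrE//.
    by case/andP: (mc y) => ? _; exact: lt_le_trans c0 _.
  rewrite RintegralZr//; last exact: bounded_integrable mC.
  by rewrite -/M divff// gt_eqF.
pose fh (z : T1 * T2) := f z * h z.2.
have mfh : measurable_fun [set: T1 * T2] fh.
  by apply: measurable_funM => //; exact: measurableT_comp.
have fhD z : `|fh z| <= C * D by exact: normM_le.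
pose A := \int[P2]_y real_entropy P1 (fun x => f (x, y)).
pose B := \int[P1]_x \int[P2]_y (f (x, y) * h y).
have mA : measurable_fun [set: T2] (fun y => real_entropy P1 (fun x => f (x, y))).
  apply: measurable_funB; first exact: (measurable_Rintegral_fst mflnf flnfK).
  exact: measurable_xlnx.
have mB : measurable_fun [set: T1] (fun x => \int[P2]_y (f (x, y) * h y)).
  exact: (measurable_Rintegral_snd mfh fhD).
have bflnf y : `|\int[P1]_x flnf (x, y)| <= K.
  rewrite ler_norml; apply: Rintegral_itv; first exact: measurable_fun_pair1.
  by move=> x; rewrite -ler_norml.
have bm y : `|m y * ln (m y)| <= K.
  by apply: normM_le; [exact: norm_itv (mc y)|exact: norm_ln_itv (mc y)].
have bA y : `|real_entropy P1 (fun x => f (x, y))| <= K + K.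
  rewrite /real_entropy (le_trans (ler_normB _ _))//.
  by apply: lerD; [exact: bflnf | exact: bm].
have bB x : `|\int[P2]_y (f (x, y) * h y)| <= C * D.
  rewrite ler_norml; apply: Rintegral_itv; first exact: (measurable_fun_pair2 x mfh).
  by move=> y; rewrite -ler_norml; exact: (fhD (x, y)).
have AE : A = \int[(P1 \x P2)%E]_z flnf z - \int[P2]_y (m y * ln (m y)).
  rewrite (Rintegral_prod21 mflnf flnfK) /A /real_entropy.
  rewrite RintegralB//.
    apply: (@bounded_integrable _ _ _ _ _ K) => //.
    exact: (measurable_Rintegral_fst mflnf flnfK).
  by apply: (@bounded_integrable _ _ _ _ _ K) => //; exact: measurable_xlnx.
have BE : B = \int[P2]_y (m y * ln (m y)) - M * ln M.
  have -> : B = \int[P2]_y (m y * ln (m y) - m y * ln M).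
    rewrite /B -(Rintegral_prod12 mfh fhD) (Rintegral_prod21 mfh fhD).
    apply: eq_Rintegral => y _; rewrite /fh/= RintegralZr//.
      by rewrite -/(m y) -mulrBr.
    apply: (@bounded_integrable _ _ _ _ _ C) => //.
    exact: measurable_fun_pair1.
  rewrite RintegralB// ?RintegralZr//.
  - exact: bounded_integrable mC.
  - by apply: (@bounded_integrable _ _ _ _ _ K) => //; exact: measurable_xlnx.
  - apply: (@bounded_integrable _ _ _ _ _ (C * `|ln M|)).
      exact: measurable_funM.
    by move=> y; exact: normM_le.
(* Chain rule: [A] is the mean entropy in the first variable, [B] the entropy of the marginal [m],
   and the integrals of [m ln m] cancel in the sum. *)
have -> : real_entropy (P1 \x P2)%E f = A + B.
  by rewrite AE BE /real_entropy fM; lra.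
rewrite EFinD ge0_integralD// leeD//.
- rewrite fubini_tonelli2// /A -(Rintegral_bounded_EFin P2 mA bA).
  apply: le_integral_nonneg => //.
    exact: measurable_fun_fubini_tonelli_G.
  by move=> y; exact: integral_ge0.
- rewrite fubini_tonelli1// /B -(Rintegral_bounded_EFin P1 mB bB).
  apply: le_integral_nonneg => //.
  + exact: measurable_fun_fubini_tonelli_F.
  + by move=> x; exact: integral_ge0.
  + move=> x; apply: (le_trans _ (ent2 x)); rewrite lee_fin.
    apply: real_entropy_ge c0 _ hD h1 => //.
    exact: measurable_fun_pair2.
Qed.

End product.

Lemma real_entropy_distribution d d' (T : measurableType d) (T' : measurableType d')
    (R : realType) (P : probability T R) (X : {RV P >-> T'}) (f : T' -> R) (c C : R) :
  measurable_fun [set: T'] f -> 0 < c -> (forall x, c <= f x <= C) ->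
  real_entropy (distribution P X) f = real_entropy P (f \o X).
Proof.
move=> mf c0 fc.
have transfer (g : T' -> R) (K : R) : measurable_fun [set: T'] g ->
    (forall x, `|g x| <= K) -> \int[distribution P X]_y g y = \int[P]_x g (X x).
  move=> mg gK; rewrite /Rintegral (integral_distribution (f := EFin \o g))//.
    exact/measurable_EFinP.
  apply: (@bounded_integrable _ _ _ _ (g \o X) K) => //.
    exact: measurableT_comp.
  by move=> x; exact: gK.
rewrite /real_entropy (transfer f C)//; last by move=> x; exact: norm_itv (fc x).
rewrite (transfer _ (C * (`|ln c| + `|ln C|)))//; first exact: measurable_xlnx.
by move=> x; apply: normM_le; [exact: norm_itv (fc x)|exact: norm_ln_itv (fc x)].
Qed.

Section tensorization.
Context (R : realType) (mu : probability (measurableTypeR R) R).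

Lemma tuple_set_cons0 n (t0 t : R) (x : n.-tuple R) :
  tuple_set (tuple_cons (t0, x)) ord0 t = tuple_cons (t, x).
Proof.
apply: eq_from_tnth => j; rewrite tnth_mktuple.
have [->//|] := eqVneq j ord0.
by case: (unliftP ord0 j) => [k ->|->//]; rewrite !tnthS.
Qed.

Lemma tuple_set_consS n (t0 t : R) (x : n.-tuple R) (i : 'I_n) :
  tuple_set (tuple_cons (t0, x)) (lift ord0 i) t = tuple_cons (t0, tuple_set x i t).
Proof.
apply: eq_from_tnth => j; rewrite tnth_mktuple.
case: (unliftP ord0 j) => [k ->|->]; last by rewrite (negbTE (neq_lift _ _)).
by rewrite (inj_eq lift_inj) !tnthS tnth_mktuple.
Qed.

(** Induction on [n] through [real_entropy_prod]: [g ord0] is the energy of the first factor, and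
    the sum of the others that of the power [n], with the first coordinate frozen. Leaving the [g i]
    abstract allows infinite energies. *)
Lemma real_entropy_prob_power n (f : n.-tuple (measurableTypeR R) -> R) (c C : R)
    (g : 'I_n -> n.-tuple (measurableTypeR R) -> \bar R) :
  measurable_fun [set: n.-tuple (measurableTypeR R)] f -> 0 < c ->
  (forall x, c <= f x <= C) ->
  (forall i, measurable_fun [set: n.-tuple (measurableTypeR R)] (g i)) ->
  (forall i x, (0 <= g i x)%E) ->
  (forall i x, ((real_entropy mu (fun t => f (tuple_set x i t)))%:E
                 <= \int[mu]_t g i (tuple_set x i t))%E) ->
  ((real_entropy (prob_power mu n) f)%:E
     <= \int[prob_power mu n]_x \sum_(i < n) g i x)%E.
Proof.
elim: n f g => [|n IHn] f g mf c0 fc mg g0 ent.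
  rewrite (eq_integral (cst 0%E)); last by move=> x _; rewrite big_ord0.
  rewrite integral0 /real_entropy /=.
  have dint (h : 0.-tuple (measurableTypeR R) -> R) :
      measurable_fun [set: 0.-tuple (measurableTypeR R)] h ->
      \int[\d_([tuple] : 0.-tuple (measurableTypeR R))]_x h x = h [tuple].
    move=> mh; rewrite /Rintegral integral_dirac//; last exact/measurable_EFinP.
    by rewrite diracT mul1e.
  by rewrite !dint ?subrr//; exact: measurable_xlnx.
rewrite [prob_power mu n.+1]/=.
set Q := (mu \x prob_power mu n)%E.
pose cons := (@tuple_cons _ (measurableTypeR R) n).
have mcons : measurable_fun [set: _] cons by exact: measurable_tuple_cons.
have msum : measurable_fun [set: n.+1.-tuple (measurableTypeR R)]
    (fun x => \sum_(i < n.+1) g i x)%E by exact: emeasurable_sum.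
rewrite ge0_integral_distribution//; last by move=> x; exact: sume_ge0.
rewrite (real_entropy_distribution _ mf c0 fc).
rewrite (eq_integral (fun z => (g ord0 (cons z)
    + \sum_(i < n) g (lift ord0 i) (cons z))%E)); last first.
  by move=> z _ /=; rewrite big_ord_recl.
apply: (real_entropy_prod (g1 := g ord0 \o cons)
  (g2 := fun z => (\sum_(i < n) g (lift ord0 i) (cons z))%E) (c := c) (C := C)) => //.
- exact: measurableT_comp.
- by move=> z; exact: (fc (cons z)).
- exact: measurableT_comp.
- by apply: emeasurable_sum => i; exact: measurableT_comp.
- by move=> z; exact: (g0 ord0 (cons z)).
- by move=> z; exact: sume_ge0.
- move=> y; have := ent ord0 (cons (0, y)).
  rewrite (_ : (fun t => f _) = fun t => f (cons (t, y))); last first.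
    by apply/funext => t; rewrite tuple_set_cons0.
  by under eq_integral do rewrite tuple_set_cons0.
- move=> x.
  apply: (IHn (fun y => f (cons (x, y)))
    (fun i y => g (lift ord0 i) (cons (x, y)))) => //.
  + exact: (measurable_fun_pair2 x (measurableT_comp mf mcons)).
  + by move=> i; exact: (measurable_fun_pair2 x (measurableT_comp (mg _) mcons)).
  + move=> i y; have := ent (lift ord0 i) (cons (x, y)).
    rewrite (_ : (fun t => f _) = fun t => f (cons (x, tuple_set y i t))); last first.
      by apply/funext => t; rewrite tuple_set_consS.
    by under eq_integral do rewrite tuple_set_consS.
Qed.

End tensorization.

(** * Herbst's argument *)

(** From [1 - u <= expR (- u)] one gets [expR u <= 1 / (1 - u)], and
    [(1 - u) * (1 + u + 2 * u ^+ 2)] exceeds 1 by [u ^+ 2 * (1 - 2 * u)]. *)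
Lemma expR_le_quadratic (R : realType) (u : R) : u <= 2^-1 ->
  expR u <= 1 + u + 2 * u ^+ 2.
Proof.
move=> u2; have := expR_ge1Dx (- u); rewrite expRN => h.
have e0 := expR_gt0 u.
have h1 : (1 - u) * expR u <= 1.
  have := ler_wpM2r (ltW e0) h; rewrite mulVf ?gt_eqF//.
have h2 : 1 <= (1 - u) * (1 + u + 2 * u ^+ 2).
  have : 0 <= u ^+ 2 * (1 - 2 * u) by rewrite mulr_ge0 ?sqr_ge0//; lra.
  by move=> h2; rewrite -subr_ge0 (_ : _ - _ = u ^+ 2 * (1 - 2 * u))//; ring.
have u1 : 0 < 1 - u by lra.
by rewrite -(ler_pM2l u1) (le_trans h1).
Qed.

Lemma bernoulli_ineq (R : realType) (x : R) n : 0 <= x ->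
  1 + n%:R * x <= (1 + x) ^+ n.
Proof.
move=> x0; elim: n => [|n IHn]; first by rewrite mul0r addr0 expr0.
have x1 : 0 <= 1 + x by lra.
rewrite exprS (le_trans _ (ler_wpM2l x1 IHn))// -natr1.
have : 0 <= n%:R * x ^+ 2 by rewrite mulr_ge0 ?sqr_ge0.
lra.
Qed.

(** Here [b] is the integral of [G] against the density [e^(tG)] of mass [z], and [ls], [lt] are the
    log-Laplace values at [s] and [t]. Weighting the Gibbs inequality by [t] and the entropy bound
    by [t - s] eliminates [b]. *)
Lemma herbst_step_arith (R : realFieldType) (s t z ls lt b C : R) :
  0 <= t -> s <= t -> s * b - z * ls <= t * b - z * lt ->
  t * b - z * lt <= C * t ^+ 2 * z ->
  s * z * lt <= t * z * ls + C * t ^+ 2 * z * (t - s).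
Proof.
move=> t0 st gibbs ent; have ts : 0 <= t - s by lra.
have := ler_wpM2l t0 gibbs; have := ler_wpM2l ts ent; lra.
Qed.

Lemma herbst_iter_arith (R : realFieldType) (l0 l1 l2 C q s t : R) :
  l1 <= l0 + C * q * (t - s) -> l2 <= l1 + C * q * (t * q - t) ->
  l2 <= l0 + C * q * (t * q - s).
Proof. lra. Qed.

Lemma herbst_limit_arith (R : realFieldType) (s m v C delta lambda e : R) :
  lambda * (2 * s * v) <= e / 2 -> 0 <= C * (1 + delta) * s * lambda ->
  C * lambda ^+ 2 * delta <= e / 2 ->
  (m + 2 * s * v + C * (1 + delta) * (lambda - s)) * lambda
    <= lambda * m + C * lambda ^+ 2 + e.
Proof. lra. Qed.

Section Herbst.
Context d (T : measurableType d) (R : realType) (P : probability T R).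
Variables (G : T -> R) (M C lambda : R).
Hypotheses (mG : measurable_fun [set: T] G) (GM : forall x, `|G x| <= M).
Hypotheses (M0 : 0 <= M) (C0 : 0 <= C) (lambda0 : 0 < lambda).
Hypothesis ent_le : forall s, 0 < s <= lambda ->
  real_entropy P (fun x => expR (s * G x))
    <= C * s ^+ 2 * \int[P]_x expR (s * G x).

Let Z s := \int[P]_x expR (s * G x).
Let L s := ln (Z s).

Let msG s : measurable_fun [set: T] (fun x => s * G x).
Proof. exact: measurable_funM. Qed.

Let mexp s : measurable_fun [set: T] (fun x => expR (s * G x)).
Proof. exact: measurableT_comp. Qed.

Let sGM s x : `|s * G x| <= `|s| * M.
Proof. exact: normM_le. Qed.

Let exp_itv s x : expR (- (`|s| * M)) <= expR (s * G x) <= expR (`|s| * M).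
Proof. by rewrite !ler_expR -ler_norml. Qed.

Let exp_norm s x : `|expR (s * G x)| <= expR (`|s| * M).
Proof. exact: norm_itv (expR_gt0 _) (exp_itv s x). Qed.

Let Z_gt0 s : 0 < Z s.
Proof.
have /andP[h _] := Rintegral_itv P (mexp s) (exp_itv s).
exact: lt_le_trans (expR_gt0 _) h.
Qed.

Let iexp s : P.-integrable [set: T] (EFin \o (fun x => expR (s * G x))).
Proof. exact: bounded_integrable (exp_norm s). Qed.

Let iGexp s : P.-integrable [set: T] (EFin \o (fun x => expR (s * G x) * G x)).
Proof.
apply: (@bounded_integrable _ _ _ _ _ (expR (`|s| * M) * M)).
  exact: measurable_funM.
by move=> x; exact: normM_le.
Qed.

(* The Gibbs inequality for the tilted density [e^(tG)] and [h = sG - L s]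
   replaces the differential inequality [(L(t)/t)' <= C] of Herbst. *)
Let herbst_step s t : 0 < s -> s <= t -> t <= lambda ->
  L t / t <= L s / s + C * (t / s) * (t - s).
Proof.
move=> s0 st tl; have t0 : 0 < t by exact: lt_le_trans st.
have := @ent_le t; rewrite t0 tl -/(Z t) => /(_ isT) ent.
pose B := \int[P]_x (expR (t * G x) * G x).
have entE : real_entropy P (fun x => expR (t * G x)) = t * B - Z t * L t.
  rewrite /real_entropy -/(Z t) -/(L t) -RintegralZl//; congr (_ - _).
  by apply: eq_Rintegral => x _; rewrite expRK; ring.
have gibbs : s * B - Z t * L s <= t * B - Z t * L t.
  have sBE : s * B = \int[P]_x (s * (expR (t * G x) * G x)).
    by rewrite RintegralZl.
  have ZLE : Z t * L s = \int[P]_x (expR (t * G x) * L s) by rewrite RintegralZr.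
  rewrite -entE sBE ZLE -RintegralB//.
  - rewrite (_ : (fun x => s * _ - _)
        = fun x => expR (t * G x) * (s * G x - L s)); last first.
      by apply/funext => x; ring.
    apply: (@real_entropy_ge _ _ _ _ _ _ _ _ (`|s| * M + `|L s|)
        (mexp t) _ (expR_gt0 _) (exp_itv t)).
    + exact: measurable_funB.
    + by move=> x; rewrite (le_trans (ler_normB _ _))// lerD.
    + rewrite (_ : (fun x => _) = fun x => expR (s * G x) * (Z s)^-1); last first.
        by apply/funext => x; rewrite expRB lnK// posrE.
      by rewrite RintegralZr// -/(Z s) divff// gt_eqF.
  - exact: (integrableZl measurableT s (iGexp t)).
  - exact: (integrableZr measurableT (L s) (iexp t)).
rewrite entE in ent.
rewrite -(ler_pM2l (mulr_gt0 (mulr_gt0 s0 t0) (Z_gt0 t))).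
have -> : s * t * Z t * (L t / t) = s * Z t * L t by field; rewrite gt_eqF.
have -> : s * t * Z t * (L s / s + C * (t / s) * (t - s))
    = t * Z t * L s + C * t ^+ 2 * Z t * (t - s) by field; rewrite gt_eqF.
exact: (herbst_step_arith (ltW t0) st gibbs ent).
Qed.

(** On a geometric grid the ratio [t / s] of each step is the constant [q], so the increments
    [C * q * (t * q - t)] telescope. *)
Let herbst_iter s q n : 0 < s -> 1 <= q -> s * q ^+ n <= lambda ->
  L (s * q ^+ n) / (s * q ^+ n) <= L s / s + C * q * (s * q ^+ n - s).
Proof.
move=> s0 q1; elim: n => [|n IHn]; first by rewrite expr0 mulr1 subrr mulr0 addr0.
have q0 : 0 < q by exact: lt_le_trans q1.
rewrite exprSr mulrA; set t := s * q ^+ n in IHn * => tl.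
have t0 : 0 < t by rewrite mulr_gt0// exprn_gt0.
have ttq : t <= t * q by rewrite ler_peMr// ltW.
have := herbst_step t0 ttq tl; have := IHn (le_trans ttq tl).
rewrite (_ : t * q / t = q); last by rewrite mulrAC divff ?mul1r// gt_eqF.
exact: herbst_iter_arith.
Qed.

(** Quantitative form of [L s / s --> E[G]] as [s] tends to 0, the initial value of Herbst's
    argument: [ln Z <= Z - 1] combined with the quadratic bound on the exponential. *)
Let herbst_base s : 0 < s -> s * M <= 2^-1 ->
  L s / s <= \int[P]_x G x + 2 * s * M ^+ 2.
Proof.
move=> s0 sM.
rewrite ler_pdivrMr//.
have iG : P.-integrable [set: T] (EFin \o G) by exact: bounded_integrable GM.
have isG := integrableZl measurableT s iG.
have ic k : P.-integrable [set: T] (EFin \o (fun=> k : R)).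
  exact: (@bounded_integrable _ _ _ _ _ `|k|).
have lnZ : L s <= Z s - 1.
  by rewrite /L -{1}(subrK 1 (Z s)) addrC le_ln1Dx// ltrBrDl subrr.
have : Z s <= \int[P]_x (1 + s * G x + 2 * (s * M) ^+ 2).
  apply: le_Rintegral => //.
    exact: (integrableD measurableT (integrableD measurableT (ic 1) isG) (ic _)).
  move=> x _; have hx := sGM s x; rewrite (gtr0_norm s0) in hx.
  apply: (le_trans (expR_le_quadratic _)).
    by rewrite (le_trans _ sM)// (le_trans (ler_norm _) hx).
  rewrite lerD2l ler_pM2l// -real_normK ?num_real// ler_pXn2r// ?nnegrE//.
  by rewrite mulr_ge0// ltW.
rewrite RintegralD//; last first.
  exact: (integrableD measurableT (ic 1) isG).
rewrite RintegralD// RintegralZl// !Rintegral_prob_cst.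
lra.
Qed.

Lemma Herbst_mgf :
  \int[P]_x expR (lambda * G x) <= expR (lambda * \int[P]_x G x + C * lambda ^+ 2).
Proof.
rewrite -/(Z lambda) -[leLHS]lnK ?posrE// ler_expR -/(L lambda).
apply/ler_addgt0Pr => e e0.
(* The grid ratio is [1 + delta]. Half of [e] pays for its excess over 1; the [+ 1] keeps the
   denominator positive when [C] is 0. *)
pose delta := e / (2 * (C * lambda ^+ 2 + 1)).
have Cl : 0 <= C * lambda ^+ 2 by rewrite mulr_ge0// sqr_ge0.
have delta0 : 0 < delta by rewrite divr_gt0//; lra.
have deltaE : C * lambda ^+ 2 * delta <= e / 2.
  rewrite /delta mulrA ler_pdivrMr; last lra.
  have : 0 <= C * lambda ^+ 2 * e by rewrite mulr_ge0// ltW.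
  lra.
(* The first bound puts [s * M] below 1/2, as [herbst_base] demands; the second makes its error,
   multiplied by [lambda], at most [e / 2]. *)
pose s0 := Num.min (1 / (2 * (M + 1))) (e / (4 * lambda * (M ^+ 2 + 1))).
have M20 : 0 <= M ^+ 2 by rewrite sqr_ge0.
have M1 : 0 < 2 * (M + 1) by have := M0; lra.
have lM0 : 0 < 4 * lambda * (M ^+ 2 + 1) by rewrite !mulr_gt0//; lra.
have s00 : 0 < s0.
  by rewrite lt_min !divr_gt0.
(* By Bernoulli's inequality this [n] gives [lambda <= s0 * (1 + delta) ^+ n], so the grid ending at
   [lambda] starts below [s0]. *)
have [n hn] : exists n : nat, lambda / (s0 * delta) <= n%:R.
  exists (Num.truncn (lambda / (s0 * delta))).+1; apply/ltW; exact: truncnS_gt.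
have q0 : 0 < 1 + delta by lra.
pose s := lambda / (1 + delta) ^+ n.
have ss0 : s <= s0.
  rewrite /s ler_pdivrMr ?exprn_gt0//.
  rewrite (ler_pdivrMr _ _ (mulr_gt0 s00 delta0)) in hn.
  have := ler_wpM2l (ltW s00) (bernoulli_ineq n (ltW delta0)).
  lra.
have sgt0 : 0 < s by rewrite divr_gt0// exprn_gt0.
have sl : s * (1 + delta) ^+ n = lambda.
  by rewrite /s divfK// lt0r_neq0// exprn_gt0.
have sM : s * M <= 2^-1.
  apply: (@le_trans _ _ (s0 * M)); first by rewrite ler_wpM2r.
  have : s0 <= 1 / (2 * (M + 1)) by rewrite ge_min lexx.
  rewrite ler_pdivlMr//; lra.
have sM2 : lambda * (2 * s * M ^+ 2) <= e / 2.
  have : s0 <= e / (4 * lambda * (M ^+ 2 + 1)) by rewrite ge_min lexx orbT.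
  rewrite ler_pdivlMr//.
  have : lambda * M ^+ 2 * s <= lambda * M ^+ 2 * s0.
    by rewrite ler_wpM2l// mulr_ge0// ltW.
  have : 0 < s0 * lambda by rewrite mulr_gt0.
  lra.
have q1 : 1 <= 1 + delta by lra.
have := herbst_iter sgt0 q1 (n := n); rewrite sl lexx => /(_ isT) h1.
have h2 := herbst_base sgt0 sM.
have h3 : L lambda / lambda
    <= \int[P]_x G x + 2 * s * M ^+ 2 + C * (1 + delta) * (lambda - s).
  by rewrite (le_trans h1)// lerD2r.
have h4 : 0 <= C * (1 + delta) * s * lambda.
  apply: mulr_ge0 (ltW lambda0); apply: mulr_ge0 (ltW sgt0).
  exact: mulr_ge0 (ltW q0).
rewrite ler_pdivrMr// in h3; apply: (le_trans h3).
exact: herbst_limit_arith sM2 h4 deltaE.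
Qed.

End Herbst.

(** * Local slopes and measurability *)

Section local_slope.
Context (R : realType).
Implicit Types (f g : R -> R) (x y c r : R).

Let quot f x r := ereal_sup [set (`|f x - f y| / `|x - y|)%:E
  | y in [set y | y != x /\ `|x - y| <= r]].

(** The supremum of quotients is nondecreasing in the radius, so its limit at [0^'+] is an infimum
    over positive radii. *)
Let local_slopeE f x : local_slope f x =
  fine (ereal_inf [set quot f x r | r in `]0, +oo[]).
Proof.
rewrite /local_slope; congr fine; apply: cvg_lim => //.
apply: (nondecreasing_at_right_cvge (f := quot f x) +oo%O) => //.
move=> r s _ _ rs; apply: le_ereal_sup => _ [y [yx yr] <-].
by exists y => //; split => //; exact: le_trans rs.
Qed.

Let quot_ge0 f x r : 0 < r -> (0 <= quot f x r)%E.
Proof.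
(* A witness is required, the supremum of an empty family being [-oo]; [x + r] lies in the punctured
   ball. *)
move=> r0; apply: (@le_trans _ _ (`|f x - f (x + r)| / `|x - (x + r)|)%:E).
  by rewrite lee_fin divr_ge0.
apply: ereal_sup_ubound; exists (x + r) => //; split.
  by rewrite -subr_eq0 addrAC subrr add0r gt_eqF.
by rewrite opprD addrA subrr add0r normrN gtr0_norm.
Qed.

Let inf_ge0 f x : (0 <= ereal_inf [set quot f x r | r in `]0%R, +oo[])%E.
Proof.
apply: le_ereal_inf_tmp => _ [r + <-]; rewrite /= in_itv/= andbT.
exact: quot_ge0.
Qed.

Lemma local_slope_ge0 f x : 0 <= local_slope f x.
Proof. by rewrite local_slopeE fine_ge0. Qed.

Let quot_le f x r c : 0 <= c ->
  (forall y, `|x - y| <= r -> `|f x - f y| <= c * `|x - y|) ->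
  (quot f x r <= c%:E)%E.
Proof.
move=> c0 fc; apply: ge_ereal_sup => _ [y [yx yr] <-].
rewrite lee_fin ler_pdivrMr ?fc// normr_gt0 subr_eq0 eq_sym.
exact: yx.
Qed.

Lemma local_slope_le f x c : 0 <= c ->
  (forall e, 0 < e -> exists2 r, 0 < r &
    forall y, `|x - y| <= r -> `|f x - f y| <= (c + e) * `|x - y|) ->
  local_slope f x <= c.
Proof.
move=> c0 fc; rewrite local_slopeE.
have infc : (ereal_inf [set quot f x r | r in `]0%R, +oo[] <= c%:E)%E.
  apply/lee_addgt0Pr => e e0; have [r r0 fr] := fc _ e0.
  apply: (@le_trans _ _ (quot f x r)).
    by apply: ereal_inf_lbound; exists r => //=; rewrite in_itv/= r0.
  by apply: quot_le => //; rewrite addr_ge0// ltW.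
rewrite -lee_fin fineK// ge0_fin_numE//.
by rewrite (le_lt_trans infc)// ltry.
Qed.

(** Converse of [local_slope_le]. The Lipschitz bound near [x] makes the infimum finite; for an
    infinite one [fine] would return 0 and the conclusion could fail. *)
Lemma local_slope_bound f x L r0 : 0 < r0 ->
  (forall y, `|x - y| <= r0 -> `|f x - f y| <= L * `|x - y|) ->
  forall e, 0 < e -> exists2 r, 0 < r &
    forall y, `|x - y| <= r -> `|f x - f y| <= (local_slope f x + e) * `|x - y|.
Proof.
move=> r00 fL e e0.
have fin : ereal_inf [set quot f x r | r in `]0%R, +oo[] \is a fin_num.
  rewrite ge0_fin_numE// (@le_lt_trans _ _ `|L|%:E) ?ltry//.
  apply: (@le_trans _ _ (quot f x r0)).
    by apply: ereal_inf_lbound; exists r0 => //=; rewrite in_itv/= r00.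
  apply: quot_le => // y yr; rewrite (le_trans (fL _ yr))// ler_wpM2r//.
  exact: ler_norm.
have [_ [r + <-]] := lb_ereal_inf_adherent e0 fin.
rewrite /= in_itv/= andbT => rgt0 quotr; exists r => // y yr.
have [->|xy] := eqVneq y x; first by rewrite !subrr normr0 mulr0.
have xy0 : 0 < `|x - y| by rewrite normr_gt0 subr_eq0 eq_sym.
rewrite -ler_pdivrMr// local_slopeE -lee_fin EFinD fineK//.
apply: (le_trans _ (ltW quotr)).
by apply: ereal_sup_ubound; exists y.
Qed.

End local_slope.

Section locally_lipschitz.
Context (R : realType).

(** [locally] refers to points of [V * V], whence two base points; the case [x1 = x2] is the usual
    local Lipschitz condition. *)
Lemma locally_lipschitzP (V : normedModType R) (f : V -> R) :
  [locally [lipschitz f v | v in [set: V]]] <->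
  forall x1 x2 : V, exists2 L : R, 0 < L & exists2 r : R, 0 < r &
    forall y1 y2, `|x1 - y1| < r -> `|x2 - y2| < r ->
      `|f y1 - f y2| <= L * `|y1 - y2|.
Proof.
split.
  move=> fl x1 x2.
  have [L L0] := pinfty_ex_gt0 (fl (x1, x2) (conj I I)).
  rewrite /dominated_by /within /= => /nbhs_ballP[r r0 H].
  exists L => //; exists r => // y1 y2 h1 h2.
  apply: (H (y1, y2)); last by [].
  by split; rewrite -ball_normE.
move=> fl [x1 x2] _; have [L L0 [r r0 H]] := fl x1 x2.
exists L; split; first exact: num_real.
move=> M LM; rewrite /dominated_by /within /=.
apply/nbhs_ballP; exists r => // -[y1 y2] [] /=.
rewrite -ball_normE /= => h1 h2 _; rewrite (le_trans (H _ _ h1 h2))//.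
by rewrite ler_wpM2r// ltW.
Qed.
End locally_lipschitz.

Section loc_lipschitz_tuple.
Context (R : realType) (n : nat).
Implicit Types (F : n.-tuple R -> R) (x y : n.-tuple R).

Lemma loc_lipschitz_tupleP F : loc_lipschitz_tuple F ->
  forall x1 x2, exists2 L : R, 0 < L & exists2 r : R, 0 < r &
    forall y1 y2 (e : R), 0 <= e ->
      (forall i, `|tnth x1 i - tnth y1 i| < r) ->
      (forall i, `|tnth x2 i - tnth y2 i| < r) ->
      (forall i, `|tnth y1 i - tnth y2 i| <= e) -> `|F y1 - F y2| <= L * e.
Proof.
pose row_of (x : n.-tuple R) : 'rV[R]_n := \row_i tnth x i.
have rowK x : on_rows F (row_of x) = F x.
  by congr F; apply: eq_from_tnth => i; rewrite tnth_mktuple mxE.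
move=> /locally_lipschitzP FL x1 x2.
have [L L0 [r r0 H]] := FL (row_of x1) (row_of x2).
exists L => //; exists r => // y1 y2 e e0 h1 h2 h12.
rewrite -!rowK (le_trans (H _ _ _ _))//.
- rewrite /Num.norm/= mx_normrE; apply: bigmax_lt => // -[i j] _ /=.
  by rewrite !mxE; exact: h1.
- rewrite /Num.norm/= mx_normrE; apply: bigmax_lt => // -[i j] _ /=.
  by rewrite !mxE; exact: h2.
- rewrite ler_pM2l// [leLHS]/Num.norm/= mx_normrE; apply: bigmax_le => // -[i j] _ /=.
  by rewrite !mxE; exact: h12.
Qed.

Lemma loc_lipschitz_tuple_set F x (i : 'I_n) : loc_lipschitz_tuple F ->
  loc_lipschitz (fun t => F (tuple_set x i t)).
Proof.
move=> /loc_lipschitz_tupleP FL; apply/locally_lipschitzP => t1 t2.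
have [L L0 [r r0 H]] := FL (tuple_set x i t1) (tuple_set x i t2).
have dist (s t : R) (j : 'I_n) :
    `|tnth (tuple_set x i s) j - tnth (tuple_set x i t) j| <= `|s - t|.
  by rewrite !tnth_mktuple; case: ifP => // _; rewrite subrr normr0.
exists L => //; exists r => // s1 s2 h1 h2.
apply: H => // j; exact: le_lt_trans (dist _ _ j) _.
Qed.

Lemma loc_lipschitz_tupleN F : loc_lipschitz_tuple F ->
  loc_lipschitz_tuple (fun x => - F x).
Proof.
move=> /locally_lipschitzP FL; apply/locally_lipschitzP => x1 x2.
have [L L0 [r r0 H]] := FL x1 x2.
exists L => //; exists r => // y1 y2 h1 h2.
by rewrite /on_rows -opprD normrN; exact: H.
Qed.

End loc_lipschitz_tuple.

Section measurability.
Context (R : realType) (n : nat).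
Local Notation T := (n.-tuple (measurableTypeR R)).
Variable F : T -> R.
Hypothesis F_lip : loc_lipschitz_tuple F.

(* [F] is the pointwise limit of its values on the grids of mesh [1 / (k + 1)]. *)
Lemma measurable_loc_lipschitz_tuple : measurable_fun [set: T] F.
Proof.
pose grid (k : nat) (q : n.-tuple int) : T :=
  [tuple (tnth q i)%:~R / k.+1%:R | i < n].
pose cell k (x : T) : n.-tuple int := [tuple Num.floor (tnth x i * k.+1%:R) | i < n].
apply: (@measurable_fun_cvg _ _ _ _ (fun k x => F (grid k (cell k x)))) => [k|x _].
- move=> _ B mB; rewrite setTI.
  (* The discretized function depends only on the integer tuple [cell k x], so a preimage is a
     countable union of boxes. *)
  rewrite (_ : _ @^-1` _ = \bigcup_(q in [set: n.-tuple int])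
      (if `[< B (F (grid k q)) >] then
        \bigcap_(i in [set: 'I_n]) ((@tnth n R)^~ i @^-1`
          [set t | (Num.floor (t * k.+1%:R) == tnth q i)%R]) else set0)); last first.
    apply/seteqP; split => [x Bx|x [q _]].
      exists (cell k x) => //; case: asboolP => // _ i _ /=.
      by rewrite /cell tnth_mktuple.
    case: asboolP => // Bq xq; rewrite /preimage /=.
    suff -> : cell k x = q by [].
    by apply: eq_from_tnth => i; rewrite /cell tnth_mktuple; apply/eqP/(xq i).
  apply: countable_bigcupT_measurable; first exact: countableP.
  move=> q; case: asboolP => // _.
  apply: fin_bigcap_measurable; first exact: finite_finset.
  move=> i _; rewrite -[X in measurable X]setTI; apply: measurable_tnth => //.
  rewrite (_ : [set t | _] = [set` `[(tnth q i)%:~R / k.+1%:R,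
      ((tnth q i) + 1)%:~R / k.+1%:R[ ]); first exact: measurable_itv.
  apply/seteqP; split => t /=; rewrite in_itv/= ler_pdivrMr// ltr_pdivlMr//.
    by move=> /eqP <-; exact: floor_itv.
  by move=> ht; apply/eqP/floor_def.
- have [L L0 [r r0 H]] := loc_lipschitz_tupleP F_lip x x.
  apply/cvgrPdist_lt => e e0.
  near=> k.
  have k0 : (0 : R) < k.+1%:R^-1 by rewrite invr_gt0.
  have dist i : `|tnth x i - tnth (grid k (cell k x)) i| <= k.+1%:R^-1.
    rewrite !tnth_mktuple; set t := tnth x i.
    have /andP[h1 h2] := floor_itv (t * k.+1%:R).
    rewrite intrD in h2.
    rewrite -(ler_pM2r (x := k.+1%:R))// mulVf// -[X in `|_| * X]ger0_norm// -normrM.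
    rewrite mulrBl divfK// ger0_norm; lra.
  have kr : k.+1%:R^-1 < r.
    by near: k; apply: near_infty_natSinv_lt (PosNum r0).
  have ke : k.+1%:R^-1 < e / L.
    by near: k; apply: near_infty_natSinv_lt (PosNum (divr_gt0 e0 L0)).
  apply: (@le_lt_trans _ _ (L * k.+1%:R^-1)).
    apply: H => // i; first by rewrite subrr normr0.
    exact: le_lt_trans (dist i) _.
  by rewrite -ltr_pdivlMl// mulrC.
Unshelve. all: by end_near. Qed.

End measurability.

Section slope_rational.
Context (R : realType).
Implicit Types (f : R -> R).

Lemma loc_lipschitz_slope f x e : loc_lipschitz f -> 0 < e ->
  exists2 r, 0 < r & forall y, `|x - y| <= r ->
    `|f x - f y| <= (local_slope f x + e) * `|x - y|.
Proof.
move=> /locally_lipschitzP fL; have [L L0 [r r0 H]] := fL x x.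
apply: (@local_slope_bound _ _ _ L (r / 2)); first by rewrite divr_gt0.
move=> y xy; apply: H; first by rewrite subrr normr0.
by rewrite (le_lt_trans xy)// ltr_pdivrMr// ltr_pMr// ltr1n.
Qed.

(** All quantifiers on the right range over countable sets, which makes sublevel sets of the slope
    measurable. Rational increments suffice because [f] is Lipschitz near each [y] and the rationals
    are dense. *)
Lemma local_slope_le_ratP f x c : loc_lipschitz f -> 0 <= c ->
  local_slope f x <= c <->
  forall m : nat, exists k : nat, forall q : rat, `|ratr q : R| <= k.+1%:R^-1 ->
    `|f x - f (x + ratr q)| <= (c + m.+1%:R^-1) * `|ratr q|.
Proof.
move=> fl c0; split => [fc m|H].
  have m0 : (0 : R) < m.+1%:R^-1 by rewrite invr_gt0.
  have [r r0 fr] := loc_lipschitz_slope x fl m0.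
  have [k kr] : exists k : nat, k.+1%:R^-1 < r.
    by have [k _ /(_ k (leqnn k))] := near_infty_natSinv_lt (PosNum r0); exists k.
  exists k => q qk.
  have xq : `|x - (x + ratr q)| = `|ratr q : R|.
    by rewrite opprD addrA subrr add0r normrN.
  have := fr (x + ratr q); rewrite xq => /(_ (le_trans qk (ltW kr))) /le_trans.
  by apply; rewrite ler_wpM2r// lerD2r.
apply: local_slope_le => // e e0.
have [m _ /(_ m (leqnn m)) /= me] := near_infty_natSinv_lt (PosNum e0).
have [k Hk] := H m.
have k0 : (0 : R) < k.+1%:R^-1 by rewrite invr_gt0.
exists (k.+1%:R^-1 / 2); first by rewrite divr_gt0.
move=> y xy.
apply/ler_addgt0Pr => h h0.
move/locally_lipschitzP : fl => /(_ y y) [L L0 [r r0 fL]].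
(* Replacing [y] by [x + ratr q] within distance [d] costs at most [(c + e) * d] in the increment
   and [L * d] in the value of [f], in all [C * d <= h]. Halving the radius leaves room for [ratr q]
   to stay below [k.+1%:R^-1]. *)
pose C := c + e + L; have C0 : 0 < C by rewrite /C; lra.
pose d := Num.min (k.+1%:R^-1 / 2) (Num.min r (h / C)).
have d0 : 0 < d by rewrite !lt_min r0 !divr_gt0.
have [d1 d2 d3] : [/\ d <= k.+1%:R^-1 / 2, d <= r & d <= h / C].
  by rewrite /d !ge_min !lexx !orbT; split.
have [q] := @rat_in_itvoo _ (y - x) (y - x + d) ltac:(by rewrite ltrDl).
rewrite in_itv/= => /andP[q1 q2].
have yq : `|y - (x + ratr q)| < d by rewrite ltr_norml; apply/andP; split; lra.
have qy : `|ratr q : R| <= `|x - y| + d.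
  have -> : ratr q = (x + ratr q - y) + (y - x) :> R by lra.
  rewrite (le_trans (ler_normD _ _))// addrC distrC lerD2l distrC ltW//.
have := fL y (x + ratr q); rewrite subrr normr0 => /(_ r0 (lt_le_trans yq d2)) h1.
have qk : `|ratr q : R| <= k.+1%:R^-1.
  by rewrite (le_trans qy)// [leRHS]splitr lerD.
have h2 := Hk q qk.
have h3 : `|f x - f y| <= `|f x - f (x + ratr q)| + `|f y - f (x + ratr q)|.
  by rewrite [X in _ <= _ + X]distrC ler_distD.
apply: (le_trans h3).
have : (c + m.+1%:R^-1) * `|ratr q| <= (c + e) * (`|x - y| + d).
  by rewrite ler_pM//; [rewrite addr_ge0|rewrite lerD2l ltW].
have : L * `|y - (x + ratr q)| <= L * d by rewrite ler_pM2l// ltW.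
have : C * d <= h by rewrite mulrC -ler_pdivlMr.
rewrite /C => i1 i2 /(le_trans h2) i3; clear -h1 i1 i2 i3; lra.
Qed.

End slope_rational.

Section measurable_slope.
Context (R : realType) (n : nat).
Local Notation T := (n.-tuple (measurableTypeR R)).

Lemma tuple_set_id (x : n.-tuple R) i : tuple_set x i (tnth x i) = x.
Proof.
by apply: eq_from_tnth => j; rewrite tnth_mktuple; case: eqP => // ->.
Qed.

Lemma tuple_set_set (x : n.-tuple R) i s t :
  tuple_set (tuple_set x i s) i t = tuple_set x i t.
Proof. by apply: eq_from_tnth => j; rewrite !tnth_mktuple; case: eqP. Qed.

Lemma partial_slope_set (F : n.-tuple R -> R) x i t :
  partial_slope F i (tuple_set x i t) = local_slope (fun s => F (tuple_set x i s)) t.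
Proof.
rewrite /partial_slope tnth_mktuple eqxx; congr local_slope.
by apply/funext => s; rewrite tuple_set_set.
Qed.

Lemma measurable_partial_slope (F : T -> R) i : loc_lipschitz_tuple F ->
  measurable_fun [set: T] (partial_slope F i).
Proof.
move=> F_lip; have mF := measurable_loc_lipschitz_tuple F_lip.
apply: (measurability _ (RGenOInfty.measurableE R)) => _ [_ [c ->] <-].
rewrite setTI; have [c0|c0] := ltP c 0.
  rewrite (_ : _ @^-1` _ = setT)//; apply/seteqP; split => // x _.
  by rewrite /= in_itv/= andbT (lt_le_trans c0)// local_slope_ge0.
(* The complement of the sublevel set described by [local_slope_le_ratP]; the intersection over
   rationals is written as the complement of a union. *)
rewrite (_ : _ @^-1` _ = ~` \bigcap_(m in [set: nat]) \bigcup_(k in [set: nat])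
    ~` \bigcup_(q in [set: rat]) (if `|ratr q : R| <= k.+1%:R^-1 then
    ~` ([set: T] `&` [set x | `|F x - F (tuple_set x i (tnth x i + ratr q))|
           <= (c + m.+1%:R^-1) * `|ratr q|]) else set0)); last first.
  apply/seteqP; split => x /=; rewrite in_itv/= andbT ltNge.
    move=> /negP h H; apply: h.
    apply/(local_slope_le_ratP _ (loc_lipschitz_tuple_set x i F_lip) c0) => m.
    have [k _ Hk] := H m I; exists k => q qk; rewrite tuple_set_id.
    apply: contrapT => h; apply: Hk; exists q => //; rewrite qk => -[_].
    exact.
  move=> h; apply/negP => H; apply: h => m _.
  have [k Hk] :=
    (local_slope_le_ratP _ (loc_lipschitz_tuple_set x i F_lip) c0).1 H m.
  exists k => // -[q _]; case: ifPn => // qk; apply; split => //=.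
  by have := Hk q qk; rewrite tuple_set_id.
apply: measurableC; apply: bigcapT_measurable => m.
apply: bigcupT_measurable => k; apply: measurableC.
apply: bigcupT_measurable_rat => q; case: ifP => // _.
apply: measurableC; apply: measurable_fun_le => //.
apply: measurableT_comp => //; apply: measurable_funB => //.
apply: measurableT_comp => //; apply/measurable_fun_tnthP => j.
have mt l : measurable_fun [set: T] (fun x => tnth x l) by exact: measurable_tnth.
rewrite (_ : _ \o _ = fun x : T =>
    if j == i then tnth x i + ratr q else tnth x j); last first.
  by apply/funext => x /=; rewrite tnth_mktuple.
case: (j == i); last exact: mt.
exact: (measurable_funD (mt i) (measurable_cst (ratr q : R))).
Qed.

End measurable_slope.

(** * The cost function and truncations *)

Section cost.
Context (R : realType) (H : R -> \bar R).
Hypothesis H_ge0 : forall x, (0 <= H x)%E.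
Hypothesis H_even : even_fun H.
Hypothesis H_convex : convex_ereal H.
Hypothesis H_ratio : forall x y, 0 < x -> x <= y ->
  (H x / (x ^+ 2)%:E <= H y / (y ^+ 2)%:E)%E.
Hypothesis H_0 : H 0 = 0%E.

Lemma cost_norm x : H `|x| = H x.
Proof. by have [x0|x0] := ger0P x; rewrite ?H_even. Qed.

(** Convexity between 0 and [y], with [H 0 = 0], gives the stronger [H x <= (x / y) H y]. *)
Lemma cost_le x y : 0 <= x -> x <= y -> (H x <= H y)%E.
Proof.
move=> x0 xy; have [y0|y0] := eqVneq y 0.
  by have -> // : x = y; apply/eqP; rewrite eq_le xy y0.
have {}y0 : 0 < y by rewrite lt_neqAle eq_sym y0 (le_trans x0).
have t01 : 0 <= x / y <= 1.
  by rewrite divr_ge0 ?(ltW y0)//= ler_pdivrMr// mul1r.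
have := H_convex y 0 t01; rewrite mulr0 addr0 divfK ?gt_eqF// H_0 mule0 adde0.
move=> /le_trans; apply; have /andP[t0 t1] := t01.
by rewrite -[leRHS]mul1e lee_wpmul2r// lee_fin.
Qed.

Lemma measurable_cost : measurable_fun [set: R] H.
Proof.
apply: (measurability _ (ErealGenOInfty.measurableE R)) => _ [_ [c ->] <-].
rewrite setTI (_ : _ @^-1` _ = ~` [set x | (H x <= c%:E)%E]); last first.
  apply/seteqP; split => x /=; rewrite in_itv/= andbT ltNge; first by move/negP.
  by move=> /negP.
(* A point [z] between [x] and [y] satisfies [|z| <= max(|x|, |y|)], so evenness and monotonicity
   make sublevel sets intervals. *)
apply: measurableC; apply: is_interval_measurable => x y /= Hx Hy z /andP[xz zy].
rewrite -cost_norm; have [zx|zx] := leP `|z| `|x|.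
  by apply: (le_trans _ Hx); rewrite -[leRHS]cost_norm; apply: cost_le.
apply: (le_trans _ Hy); rewrite -[leRHS]cost_norm; apply: cost_le => //.
move: zx; rewrite ler_normr !ltr_normr.
have [z0|z0] := ger0P z; have [x0|x0] := ger0P x; lra.
Qed.

(* Since [0 ^-1 = +oo], a finite [omega H x] forces [H (t x) = 0] if [H t = 0]. *)
Lemma cost_le_omega x t : 0 < x -> 0 < t -> (H t < +oo)%E ->
  (omega H x < +oo)%E -> (H (t * x)%R <= (fine (omega H x))%:E * H t)%E.
Proof.
move=> x0 t0 Ht; rewrite /omega gt_eqF//; set m := maxe _ _ => moo.
have m0 : (0 <= m)%E by rewrite le_max lexx.
rewrite fineK ?ge0_fin_numE//.
have : (H (t * x)%R / H t <= m)%E.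
  rewrite le_max; apply/orP; right.
  by apply: ereal_sup_ubound; exists t.
have [Ht0|Ht0] := eqVneq (H t) 0%E.
  rewrite Ht0 inve0 mule0 => h.
  rewrite leNgt; apply/negP => Hp; move: h.
  by rewrite gt0_muley// leye_eq => /eqP mE; rewrite mE in moo.
have tfin : H t \is a fin_num by rewrite ge0_fin_numE.
have tpos : 0 < fine (H t).
  by rewrite fine_gt0// Ht andbT lt0e Ht0 H_ge0.
by rewrite -(fineK tfin) inver gt_eqF// lee_pdivrMr.
Qed.

(** The ratio hypothesis is used between [t * s] and [t * x]. A free constant [w] covers both
    [omega H x] and the immediate case [x = w = 1]. *)
Lemma cost_scale (x w s t : R) :
  (forall t, 0 < t -> (H t < +oo)%E -> (H (t * x)%R <= w%:E * H t)%E) ->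
  0 < s <= x -> 0 <= t -> (H t < +oo)%E ->
  (H (s * t)%R <= ((s / x) ^+ 2 * w)%:E * H t)%E.
Proof.
move=> Hw /andP[s0 sx]; rewrite le_eqVlt => /predU1P[<-|t0] Ht.
  by rewrite mulr0 H_0 mule0.
have x0 : 0 < x by exact: lt_le_trans s0 _.
have := Hw _ t0 Ht => Hxt.
rewrite EFinM -muleA.
apply: (@le_trans _ _ (((s / x) ^+ 2)%:E * H (t * x)%R)%E); last first.
  by apply: lee_wpmul2l => //; rewrite lee_fin sqr_ge0.
have ts0 : 0 < (t * s) ^+ 2 by rewrite exprn_gt0// mulr_gt0.
have tx0 : 0 < (t * x) ^+ 2 by rewrite exprn_gt0// mulr_gt0.
rewrite [s * t]mulrC; have := @H_ratio (t * s) (t * x).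
rewrite mulr_gt0// ler_pM2l// => /(_ isT sx); rewrite !inver !gt_eqF//.
rewrite lee_pdivrMr// -muleA -EFinM muleC => /le_trans; apply.
suff -> : (t * x) ^- 2 * (t * s) ^+ 2 = (s / x) ^+ 2 by [].
by field; rewrite !gt_eqF.
Qed.

End cost.

Section truncation.
Context (R : realType).
Implicit Types (M u v : R).

Definition trunc M u := Num.max (- M) (Num.min u M).

Lemma trunc_norm_le M u : 0 <= M -> `|trunc M u| <= M.
Proof.
move=> M0; rewrite ler_norml le_max lexx ge_max ge_min lexx orbT andbT /=.
by rewrite (le_trans _ M0)// oppr_le0.
Qed.

Lemma trunc_id M u : `|u| <= M -> trunc M u = u.
Proof.
by rewrite ler_norml => /andP[u1 u2]; rewrite /trunc (min_l u2) (max_r u1).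
Qed.

Lemma trunc_norm M u : 0 <= M -> `|trunc M u| = Num.min `|u| M.
Proof.
move=> M0; have [uM|Mu] := leP `|u| M; first by rewrite trunc_id.
rewrite /trunc; move: Mu; have [u0|u0] := ger0P u => Mu.
  rewrite (min_r (ltW Mu)) max_r ?ger0_norm//.
  by rewrite (le_trans _ M0)// oppr_le0.
have h : u <= - M by rewrite lerNr ltW.
rewrite min_l ?max_l ?normrN ?ger0_norm//.
by rewrite (le_trans h)// (le_trans _ M0)// oppr_le0.
Qed.

Lemma truncE M u : 0 <= M ->
  trunc M u = if u <= - M then - M else if M <= u then M else u.
Proof.
move=> M0; rewrite /trunc; have [uM|Mu] := leP u (- M).
  by rewrite max_l// ge_min uM.
have [Mu'|uM'] := leP M u; last by rewrite max_r// ltW.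
by rewrite max_r//; lra.
Qed.

Lemma truncN M u : 0 <= M -> trunc M (- u) = - trunc M u.
Proof. by move=> M0; rewrite !truncE//; do !case: ifP; lra. Qed.

Lemma trunc_lipschitz M u v : 0 <= M -> `|trunc M u - trunc M v| <= `|u - v|.
Proof.
move=> M0; have := ler_norm (u - v); have := ler_norm (- (u - v)); rewrite normrN.
rewrite !truncE// ler_norml => h1 h2; apply/andP.
by do !case: ifP; split; lra.
Qed.

Lemma le_trunc M c u : c <= M -> c <= u -> c <= trunc M u.
Proof. by move=> cM cu; rewrite /trunc le_max le_min cu cM orbT. Qed.

Lemma measurable_trunc M d (T : measurableType d) (f : T -> R) :
  measurable_fun [set: T] f -> measurable_fun [set: T] (fun x => trunc M (f x)).
Proof.
by move=> mf; apply: measurable_maxr => //; apply: measurable_minr.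
Qed.

End truncation.

(** * Slopes of exponentials of truncations *)

Section exp_trunc.
Context (R : realType).
Implicit Types (a b B s M : R) (u : R -> R).

Lemma expR_lipschitz a b B : a <= B -> b <= B ->
  `|expR a - expR b| <= expR B * `|a - b|.
Proof.
wlog ab : a b / a <= b => [th|] aB bB.
  have [ab|/ltW ba] := leP a b; first exact: th.
  by rewrite distrC [`|a - b|]distrC; exact: th.
have eab : expR a <= expR b by rewrite ler_expR.
rewrite distrC ger0_norm ?subr_ge0// [`|a - b|]distrC ger0_norm ?subr_ge0//.
have : expR b * (1 + (a - b)) <= expR b * expR (a - b).
  by rewrite ler_wpM2l ?expR_ge0// expR_ge1Dx.
rewrite -expRD (_ : b + (a - b) = a); last by ring.
have : expR b * (b - a) <= expR B * (b - a).
  by rewrite ler_wpM2r ?subr_ge0// ler_expR.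
lra.
Qed.

Definition exp_trunc s M u (t : R) : R := expR (s * trunc M (u t)).

Lemma exp_trunc_itv s M u t : 0 <= s -> 0 <= M ->
  expR (- (s * M)) <= exp_trunc s M u t <= expR (s * M).
Proof.
move=> s0 M0; rewrite !ler_expR -ler_norml normrM (ger0_norm s0).
by rewrite ler_wpM2l// trunc_norm_le.
Qed.

Lemma loc_lipschitz_exp_trunc s M u : 0 <= s -> 0 <= M -> loc_lipschitz u ->
  loc_lipschitz (exp_trunc s M u).
Proof.
move=> s0 M0 /locally_lipschitzP ul; apply/locally_lipschitzP => x1 x2.
have [L L0 [r r0 H]] := ul x1 x2.
have sM t : s * trunc M (u t) <= s * M.
  by rewrite ler_wpM2l// (le_trans (ler_norm _))// trunc_norm_le.
exists (expR (s * M) * (s + 1) * L).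
  by rewrite !mulr_gt0// ?expR_gt0// ltr_pwDr.
exists r => // y1 y2 h1 h2.
rewrite (le_trans (expR_lipschitz (sM y1) (sM y2)))// -!mulrA ler_pM2l ?expR_gt0//.
rewrite -mulrBr normrM (ger0_norm s0) ler_pM//; first lra.
by rewrite (le_trans (trunc_lipschitz _ _ M0))// H.
Qed.

(** The chain rule as an inequality, which suffices since [H] is monotone on the half-line: no case
    distinction is needed at the truncation levels [-M] and [M], truncation being 1-Lipschitz. *)
Lemma local_slope_exp_trunc s M u x : 0 < s -> 0 <= M -> loc_lipschitz u ->
  local_slope (exp_trunc s M u) x <= s * exp_trunc s M u x * local_slope u x.
Proof.
move=> s0 M0 ul; set E := exp_trunc s M u x; set l := local_slope u x.
have E0 : 0 < E by exact: expR_gt0.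
have l0 : 0 <= l by exact: local_slope_ge0.
have sE0 : 0 < s * E by rewrite mulr_gt0.
apply: local_slope_le => [|e e0]; first by rewrite mulr_ge0// ltW.
pose eta := e / 2 / (s * E); have eta0 : 0 < eta by rewrite !divr_gt0.
pose A := s * E * (l + eta).
have AE : A = s * E * l + e / 2.
  by rewrite /A /eta mulrDr [s * E * (_ / _)]mulrC divfK// gt_eqF.
have A0 : 0 < A by rewrite mulr_gt0// ltr_wpDl.
have [r r0 ur] := loc_lipschitz_slope x ul eta0.
(* The error [e] is split evenly: [eta] adds [e / 2] to the main term, and the factor [q] adds
   [A * (q - 1) = e / 2]. The radius below forces [|a - b| <= ln q], so both exponents stay below
   [a + ln q]. *)
pose q := 1 + e / (2 * A).
have q1 : 1 < q by rewrite ltrDl divr_gt0// mulr_gt0.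
have sl0 : 0 < s * (l + eta) by rewrite mulr_gt0// ltr_wpDl.
exists (Num.min r (ln q / (s * (l + eta)))).
  by rewrite lt_min r0 divr_gt0// ln_gt0.
move=> y; rewrite le_min => /andP[yr yq].
pose a := s * trunc M (u x); pose b := s * trunc M (u y).
have ab : `|a - b| <= s * (l + eta) * `|x - y|.
  rewrite /a /b -mulrBr normrM (gtr0_norm s0) -mulrA ler_pM2l//.
  by rewrite (le_trans (trunc_lipschitz _ _ M0))// ur.
have ablnq : `|a - b| <= ln q.
  by rewrite (le_trans ab)// mulrC -ler_pdivlMr.
have aB : a <= a + ln q by rewrite lerDl ln_ge0// ltW.
have bB : b <= a + ln q.
  by have := ler_norm (- (a - b)); rewrite normrN; lra.
rewrite (le_trans (expR_lipschitz aB bB))//.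
rewrite expRD lnK ?posrE ?(lt_trans _ q1)// -/E.
apply: (@le_trans _ _ (E * q * (s * (l + eta) * `|x - y|))).
  by rewrite ler_wpM2l// mulr_ge0 ?(ltW E0)//; lra.
rewrite mulrA ler_wpM2r// (_ : E * q * _ = A * q); last by rewrite /A; ring.
have -> : A * q = A + e / 2 by rewrite /q; field; rewrite gt_eqF.
by rewrite AE; lra.
Qed.

End exp_trunc.

(** The integral of a nonnegative function is a supremum over the simple functions below it, hence
    monotone without measurability. It thus applies to [energy_density], whose measurability is not
    established. *)
Lemma le_ge0_integral d (T : measurableType d) (R : realType)
    (mu : {measure set T -> \bar R}) (f g : T -> \bar R) :
  (forall x, (0 <= f x)%E) -> (forall x, (f x <= g x)%E) ->
  (\int[mu]_x f x <= \int[mu]_x g x)%E.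
Proof.
move=> f0 fg; have g0 x : (0 <= g x)%E by exact: le_trans (fg x).
rewrite !ge0_integralTE//; apply: le_ereal_sup => _ [h hf <-].
by exists h => // x; exact: le_trans (fg x).
Qed.

(** * Exponential moments of truncations *)

Lemma loc_lipschitz_continuous (R : realType) (u : R -> R) :
  loc_lipschitz u -> continuous u.
Proof.
move=> /locally_lipschitzP ul x; apply/cvgrPdist_lt => e e0.
have [L L0 [r r0 H]] := ul x x.
near=> y; have xr : `|x - y| < r by near: y; exact: cvgr_dist_lt.
have xe : `|x - y| < e / L.
  by near: y; apply: cvgr_dist_lt => //; rewrite divr_gt0.
apply: (@le_lt_trans _ _ (L * `|x - y|)); first by rewrite H// subrr normr0.
by rewrite mulrC -ltr_pdivlMr.
Unshelve. all: by end_near. Qed.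

Section mgf.
Context (R : realType) (mu : probability (measurableTypeR R) R).
Variables (H : R -> \bar R) (kappa : R).
Hypothesis H_ge0 : forall x, (0 <= H x)%E.
Hypothesis H_even : even_fun H.
Hypothesis H_convex : convex_ereal H.
Hypothesis H_ratio : forall x y, 0 < x -> x <= y ->
  (H x / (x ^+ 2)%:E <= H y / (y ^+ 2)%:E)%E.
Hypothesis H_0 : H 0 = 0%E.
Hypothesis kappa_gt0 : 0 < kappa.
Hypothesis LSI : log_sobolev_ineq mu H kappa.

Let mH : measurable_fun [set: R] H.
Proof. exact: measurable_cost. Qed.

(** The logarithmic Sobolev inequality for [f = exp_trunc s M u], whose square is
    [exp_trunc (2 * s) M u]; the slope of [f] divided by [f] is at most [s] times that of [u]. *)
Lemma real_entropy_exp_trunc (u : R -> R) (s M : R) :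
  0 < s -> 0 <= M -> loc_lipschitz u ->
  measurable_fun [set: measurableTypeR R] (local_slope u) ->
  ((real_entropy mu (exp_trunc (2 * s) M u))%:E <=
   \int[mu]_t ((kappa * exp_trunc (2 * s) M u t)%:E * H (s * local_slope u t)%R))%E.
Proof.
move=> s0 M0 ul mslope.
have fl := loc_lipschitz_exp_trunc (ltW s0) M0 ul.
set f := exp_trunc s M u in fl.
have mf2 : measurable_fun [set: measurableTypeR R] (fun t => f t ^+ 2).
  apply: measurable_funX; apply: continuous_measurable_fun.
  exact: loc_lipschitz_continuous.
have f2E t : exp_trunc (2 * s) M u t = f t ^+ 2.
  by rewrite /f /exp_trunc -expRM_natl mulrA.
have fgt0 t : 0 < f t by exact: expR_gt0.
have s20 : 0 <= 2 * s by rewrite mulr_ge0// ltW.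
have f2_itv t : expR (- (2 * s * M)) <= f t ^+ 2 <= expR (2 * s * M).
  by rewrite -f2E exp_trunc_itv.
rewrite (_ : exp_trunc _ _ _ = fun t => f t ^+ 2); last exact/funext.
rewrite -(entropyE mu mf2 (expR_gt0 _) f2_itv).
apply: (le_trans (LSI fl _)).
  by apply: (bounded_integrable mu mf2) => t; exact: norm_itv (expR_gt0 _) (f2_itv t).
rewrite [leRHS](eq_integral
    (fun t : measurableTypeR R =>
      kappa%:E * ((f t ^+ 2)%:E * H (s * local_slope u t)%R))%E); last first.
  by move=> t _; rewrite EFinM muleA.
have mI : measurable_fun [set: measurableTypeR R]
    (fun t => ((f t ^+ 2)%:E * H (s * local_slope u t)%R)%E).
  apply: emeasurable_funM; first exact/measurable_EFinP.
  by apply: (measurableT_comp mH); exact: measurable_funM.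
have I0 t : (0 <= (f t ^+ 2)%:E * H (s * local_slope u t)%R)%E.
  by rewrite mule_ge0// lee_fin sqr_ge0.
rewrite ge0_integralZl_EFin//; last exact: ltW.
apply: lee_wpmul2l; first by rewrite lee_fin ltW.
apply: le_ge0_integral => t; rewrite /energy_density gt_eqF//.
  by rewrite mule_ge0// lee_fin sqr_ge0.
rewrite muleC lee_wpmul2l ?lee_fin ?sqr_ge0//.
apply: cost_le => //; first by rewrite divr_ge0 ?local_slope_ge0// ltW.
rewrite ler_pdivrMr// [leRHS]mulrAC; exact: local_slope_exp_trunc.
Qed.

Context (n : nat).
Local Notation T := (n.-tuple (measurableTypeR R)).
Local Notation P := (prob_power mu n).

Lemma mgf_trunc_le (F : T -> R) (a x w M : R) : loc_lipschitz_tuple F ->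
  {ae P, forall y, (\sum_(i < n) H (partial_slope F i y) <= a%:E)%E} ->
  0 < a -> 0 < x -> 0 <= w -> 0 <= M ->
  (forall t, 0 < t -> (H t < +oo)%E -> (H (t * x)%R <= w%:E * H t)%E) ->
  \int[P]_y expR (2 * x * trunc M (F y))
    <= expR (2 * x * \int[P]_y trunc M (F y) + a * kappa * w).
Proof.
move=> F_lip F_grad a0 x0 w0 M0 Hw.
pose G y := trunc M (F y).
have mG : measurable_fun [set: T] G.
  by apply: measurable_trunc; exact: measurable_loc_lipschitz_tuple.
have GM y : `|G y| <= M by exact: trunc_norm_le.
have x20 : 0 < 2 * x by rewrite mulr_gt0.
(* Chosen so that [C * lambda ^+ 2] in [Herbst_mgf], at [lambda = 2 * x], is [a * kappa * w]. *)
pose C := a * kappa * w / (2 * x) ^+ 2.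
have C0 : 0 <= C by rewrite divr_ge0 ?sqr_ge0// !mulr_ge0// ltW.
have -> : a * kappa * w = C * (2 * x) ^+ 2 by rewrite divfK// lt0r_neq0// exprn_gt0.
apply: (Herbst_mgf mG GM M0 C0 x20) => s' /andP[s'0 s'x].
pose s := s' / 2; have s'E : s' = 2 * s by rewrite /s; lra.
have s0 : 0 < s by rewrite divr_gt0.
have sx : 0 < s <= x by rewrite s0 /=; lra.
have E_itv y : expR (- (s' * M)) <= expR (s' * G y) <= expR (s' * M).
  exact: (@exp_trunc_itv _ s' M id (F y) (ltW s'0) M0).
have mE : measurable_fun [set: T] (fun y => expR (s' * G y)).
  by apply: measurableT_comp => //; exact: measurable_funM.
have mps i : measurable_fun [set: T] (partial_slope F i).
  exact: measurable_partial_slope.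
pose g i y := ((kappa * expR (s' * G y))%:E * H (s * partial_slope F i y)%R)%E.
have mg i : measurable_fun [set: T] (g i).
  apply: emeasurable_funM; first by apply/measurable_EFinP; exact: measurable_funM.
  by apply: (measurableT_comp mH); exact: measurable_funM.
have g0 i y : (0 <= g i y)%E.
  by rewrite mule_ge0// lee_fin mulr_ge0 ?expR_ge0// ltW.
have mset z i : measurable_fun [set: measurableTypeR R]
    (fun t => tuple_set z i t : T).
  apply/measurable_fun_tnthP => j.
  rewrite (_ : _ \o _ = fun t => if j == i then t else tnth z j); last first.
    by apply/funext => t /=; rewrite tnth_mktuple.
  by case: (j == i).
rewrite -lee_fin.
apply: (le_trans (real_entropy_prob_power mE (expR_gt0 _) E_itv mg g0 _)).
  move=> i z.
  have ul := loc_lipschitz_tuple_set z i F_lip.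
  have := real_entropy_exp_trunc s0 M0 ul; rewrite -s'E => ent.
  rewrite (eq_integral (fun t : measurableTypeR R => (kappa * exp_trunc s' M
      (fun t => F (tuple_set z i t)) t)%:E *
      H (s * local_slope (fun t => F (tuple_set z i t)) t)%R)%E); last first.
    by move=> t _; rewrite /g partial_slope_set.
  apply: ent.
  rewrite (_ : local_slope _ = fun t => partial_slope F i (tuple_set z i t)).
    exact: (measurableT_comp (mps i) (mset z i)).
  by apply/funext => t; rewrite partial_slope_set.
have -> : (C * s' ^+ 2 * \int[P]_y expR (s' * G y))%:E =
    (\int[P]_y (C * s' ^+ 2 * expR (s' * G y))%:E)%E.
  rewrite EFinM -(@Rintegral_bounded_EFin _ _ _ _ _ (expR (s' * M)) mE); last first.
    by move=> y; exact: norm_itv (expR_gt0 _) (E_itv y).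
  rewrite -ge0_integralZl_EFin//.
  - exact/measurable_EFinP.
  - by rewrite mulr_ge0// sqr_ge0.
apply: ae_ge0_le_integral => //.
- by move=> y _; exact: sume_ge0.
- exact: emeasurable_sum.
- by move=> y _; rewrite lee_fin mulr_ge0 ?expR_ge0// mulr_ge0// sqr_ge0.
- by apply/measurable_EFinP; exact: measurable_funM.
have [N [mN N0 subN]] := F_grad.
(* Off the exceptional set of [F_grad] the integrands compare pointwise, by [kappa * ((s / x) ^+ 2 *
   w) * a = C * s' ^+ 2]. *)
exists N; split => // y /= badH; apply: subN => /= Hy; apply: badH => _.
rewrite /g -ge0_sume_distrr//.
apply: (@le_trans _ _ ((kappa * expR (s' * G y))%:E *
    (((s / x) ^+ 2 * w)%:E * a%:E))%E); last first.
  rewrite -!EFinM lee_fin le_eqVlt; apply/orP; left; apply/eqP.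
  by rewrite /C s'E; field; rewrite gt_eqF.
have sxw : 0 <= (s / x) ^+ 2 * w by rewrite mulr_ge0// sqr_ge0.
apply: lee_wpmul2l; first by rewrite lee_fin mulr_ge0 ?expR_ge0// ltW.
apply: (le_trans _ (lee_wpmul2l _ Hy)); last by rewrite lee_fin.
rewrite ge0_sume_distrr//; apply: lee_sum => i _.
apply: (cost_scale H_ratio H_0 Hw sx); first exact: local_slope_ge0.
(* [cost_scale] asks for a finite [H] at each partial slope: every nonnegative term is below the
   sum, hence below [a]. *)
apply: (le_lt_trans _ (ltry a)); apply: (le_trans _ Hy).
by rewrite (bigD1 i)//= leeDl// sume_ge0.
Qed.

End mgf.

(** * Integrability and deviation *)

Section truncated_limits.
Context d (T : measurableType d) (R : realType) (P : probability T R).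
Variable F : T -> R.
Hypothesis mF : measurable_fun [set: T] F.

Let FN (N : nat) (x : T) := trunc N%:R (F x).

Let mFN N : measurable_fun [set: T] (FN N).
Proof. exact: measurable_trunc. Qed.

Let FN_le N x : `|FN N x| <= N%:R.
Proof. exact: trunc_norm_le. Qed.

Let iFN N : P.-integrable [set: T] (EFin \o FN N).
Proof. exact: bounded_integrable (FN_le N). Qed.

Let FN_near x : \forall N \near \oo, FN N x = F x.
Proof.
near=> N; apply: trunc_id; near: N; exact: nbhs_infty_ger.
Unshelve. all: by end_near. Qed.

Lemma cvg_Rintegral_trunc : P.-integrable [set: T] (EFin \o F) ->
  \int[P]_x trunc N%:R (F x) @[N --> \oo] --> \int[P]_x F x.
Proof.
move=> iF.
have mEF : measurable_fun [set: T] (EFin \o F) by exact/measurable_EFinP.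
have mEFN N : measurable_fun [set: T] (fun x => (FN N x)%:E).
  exact/measurable_EFinP.
have iabs : P.-integrable [set: T] (fun x => `|F x|%:E) := integrable_norm iF.
have FN_cvg : {ae P, forall x, [set: T] x -> (FN N x)%:E @[N --> \oo] --> (F x)%:E}.
  apply/aeW => x _; apply: cvg_near_cst.
  by have := FN_near x; apply: filterS => N ->.
have FN_dom : {ae P, forall x N, [set: T] x -> (`|(FN N x)%:E| <= `|F x|%:E)%E}.
  by apply/aeW => x N _; rewrite lee_fin trunc_norm// ge_min lexx.
have [_ _ h] := dominated_convergence measurableT mEFN mEF FN_cvg iabs FN_dom.
apply: fine_cvg; rewrite /= /Rintegral fineK; first exact: h.
exact: (integrable_fin_num measurableT iF).
Qed.

Let measurable_ball_preimage (k : nat) : measurable [set x | `|F x| <= k%:R].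
Proof.
rewrite -[X in measurable X]setTI; apply: measurable_fun_le => //.
exact: measurableT_comp.
Qed.

(** [F] is finite everywhere, so continuity from below applies before any integrability is known.
    The set anchors the means of the truncations. *)
Lemma exists_half_ball : exists A : nat, 1 / 2 <= fine (P [set x | `|F x| <= A%:R]).
Proof.
have bigD : \bigcup_k [set x | `|F x| <= k%:R] = [set: T].
  apply/seteqP; split => // x _; exists (Num.truncn `|F x|).+1 => //=.
  exact/ltW/truncnS_gt.
have : P [set x | `|F x| <= k%:R] @[k --> \oo] --> P [set: T].
  rewrite -bigD; apply: nondecreasing_cvg_mu => //; first by rewrite bigD.
  move=> k m km; apply/subsetPset => x /= /le_trans; apply.
  by rewrite ler_nat.
rewrite [P setT](probability_setT P) => /fine_cvg/cvgrPdist_lt/(_ (1 / 2)).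
rewrite divr_gt0// => /(_ isT) [A _ /(_ A (leqnn A))] /= h.
by exists A; move: h; rewrite ltr_norml => /andP[_ ]; lra.
Qed.

(** By [2 |u| <= e^(2u) + e^(-2u)], the two hypotheses bound each truncation in [L^1] only around
    its own mean [m N], which might drift to infinity. On a set of mass at least 1/2 where
    [|F| <= A], however, [|m N| <= |FN N - m N| + A], which bounds [m N]. Monotone convergence then
    passes to [|F|]. *)
Lemma integrable_trunc_mgf (B : R) :
  (forall N : nat, \int[P]_x expR (2 * trunc N%:R (F x))
     <= expR (2 * \int[P]_x trunc N%:R (F x) + B)) ->
  (forall N : nat, \int[P]_x expR (2 * trunc N%:R (- F x))
     <= expR (2 * \int[P]_x trunc N%:R (- F x) + B)) ->
  P.-integrable [set: T] (EFin \o F).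
Proof.
move=> mgf mgfN.
pose m N := \int[P]_x FN N x.
have idev N : P.-integrable [set: T] (EFin \o (fun x => `|FN N x - m N|)).
  apply: (@bounded_integrable _ _ _ _ _ (N%:R + `|m N|)).
    by apply: measurableT_comp => //; exact: measurable_funB.
  by move=> x; rewrite normr_id (le_trans (ler_normB _ _))// lerD2r.
have dev N : \int[P]_x `|FN N x - m N| <= expR B.
  have iexp s : P.-integrable [set: T] (EFin \o (fun x => expR (s * FN N x))).
    apply: (@bounded_integrable _ _ _ _ _ (expR (`|s| * N%:R))).
      by apply: measurableT_comp => //; exact: measurable_funM.
    move=> x; rewrite ger0_norm ?expR_ge0// ler_expR (le_trans (ler_norm _))//.
    exact: normM_le.
  have h1 : \int[P]_x (expR (2 * FN N x) * expR (- (2 * m N))) <= expR B.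
    rewrite RintegralZr// (le_trans (ler_wpM2r (expR_ge0 _) (mgf N)))//.
    by rewrite -expRD addrAC subrr add0r.
  have h2 : \int[P]_x (expR (- 2 * FN N x) * expR (2 * m N)) <= expR B.
    have h x : - 2 * FN N x = 2 * trunc N%:R (- F x) by rewrite truncN// /FN; ring.
    rewrite RintegralZr//; under eq_Rintegral do rewrite h.
    rewrite (le_trans (ler_wpM2r (expR_ge0 _) (mgfN N)))// -expRD ler_expR.
    under eq_Rintegral do rewrite truncN// -mulN1r.
    by rewrite RintegralZl//; [rewrite -/(m N); lra|exact: iFN].
  have e1 := integrableZr measurableT (expR (- (2 * m N))) (iexp 2).
  have e2 := integrableZr measurableT (expR (2 * m N)) (iexp (- 2)).
  have : \int[P]_x (2 * `|FN N x - m N|) <=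
      \int[P]_x (expR (2 * FN N x) * expR (- (2 * m N))
               + expR (- 2 * FN N x) * expR (2 * m N)).
    apply: le_Rintegral => //.
    - exact: (integrableZl measurableT 2 (idev N)).
    - exact: (integrableD measurableT e1 e2).
    move=> x _; rewrite -!expRD; set u := FN N x - m N.
    rewrite (_ : 2 * FN N x - 2 * m N = 2 * u); last by rewrite /u; ring.
    rewrite (_ : - 2 * FN N x + 2 * m N = - (2 * u)); last by rewrite /u; ring.
    have := expR_ge0 (2 * u); have := expR_ge0 (- (2 * u)).
    have := expR_ge1Dx (2 * u); have := expR_ge1Dx (- (2 * u)).
    by have [u0|u0] := ger0P u; lra.
  by rewrite RintegralZl// RintegralD//; lra.
have [A hA] := exists_half_ball.
pose D := [set x | `|F x| <= A%:R].
have mD : measurable D by exact: measurable_ball_preimage.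
have mbound N : (A <= N)%N -> `|m N| <= 2 * (expR B + A%:R).
  move=> AN.
  have iA : P.-integrable [set: T] (EFin \o (fun=> A%:R : R)).
    exact: (@bounded_integrable _ _ _ _ _ `|A%:R|).
  have iD : P.-integrable [set: T] (EFin \o (\1_D : T -> R)).
    exact: integrable_indic.
  have : \int[P]_x (`|m N| * \1_D x) <= \int[P]_x (`|FN N x - m N| + A%:R).
    apply: le_Rintegral => //.
    - exact: (integrableZl measurableT _ iD).
    - exact: (integrableD measurableT (idev N) iA).
    move=> x _; rewrite indicE; have [xD|xD] := boolP (x \in D).
      have := ler_normB (FN N x) (FN N x - m N); rewrite opprB addrC subrK mulr1.
      move=> /le_trans; apply; rewrite addrC lerD2l.
      move: xD; rewrite inE /D/= => xA.
      by rewrite /FN trunc_id// (le_trans xA)// ler_nat.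
    by rewrite mulr0 addr_ge0.
  rewrite RintegralZl// RintegralD// Rintegral_prob_cst.
  have -> : \int[P]_x (\1_D x : R) = fine (P D).
    by rewrite /Rintegral integral_indic// setIT.
  have := dev N.
  have : `|m N| * (1 / 2) <= `|m N| * fine (P D) by rewrite ler_wpM2l.
  lra.
have FNbound N : (A <= N)%N ->
    (\int[P]_x `|FN N x|%:E <= (expR B + 2 * (expR B + A%:R))%:E)%E.
  move=> AN.
  rewrite (@Rintegral_bounded_EFin _ _ _ _ _ N%:R); last 2 first.
  - exact: measurableT_comp.
  - by move=> x; rewrite normr_id.
  have ic : P.-integrable [set: T] (EFin \o (fun=> `|m N|)).
    by apply: (@bounded_integrable _ _ _ _ _ `|m N|) => // x; rewrite normr_id.
  rewrite lee_fin (@le_trans _ _ (\int[P]_x (`|FN N x - m N| + `|m N|)))//.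
    apply: le_Rintegral => //.
    - exact: (integrable_norm (iFN N)).
    - exact: (integrableD measurableT (idev N) ic).
    by move=> x _; rewrite -{1}(subrK (m N) (FN N x)) ler_normD.
  by rewrite RintegralD// Rintegral_prob_cst lerD// mbound.
apply/integrableP; split; first exact/measurable_EFinP.
apply: (@le_lt_trans _ _ (expR B + 2 * (expR B + A%:R))%:E); last exact: ltry.
have := @cvg_monotone_convergence _ _ _ P _ measurableT (fun N x => `|FN N x|%:E).
rewrite (_ : (fun x => limn _) = fun x => `|F x|%:E); last first.
  apply/funext => x; apply: cvg_lim => //; apply: cvg_near_cst.
  by have := FN_near x; apply: filterS => N ->.
move=> mono; apply: (cvge_le _ (mono _ _ _)).
- by near=> N; apply: FNbound; near: N; exact: nbhs_infty_ge.
- by move=> N; apply/measurable_EFinP; exact: measurableT_comp.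
- by move=> N x _; rewrite lee_fin.
- move=> x _ N M NM; rewrite lee_fin !trunc_norm// le_min !ge_min lexx/=.
  by rewrite ler_nat NM orbT.
Unshelve. all: by end_near. Qed.

End truncated_limits.

Section deviation.
Context d (T : measurableType d) (R : realType) (P : probability T R).

Lemma exp_markov (G : T -> R) (M lambda c : R) :
  measurable_fun [set: T] G -> (forall x, `|G x| <= M) -> 0 <= lambda ->
  expR (lambda * c) * fine (P [set x | c <= G x]) <= \int[P]_x expR (lambda * G x).
Proof.
move=> mG GM l0; set A := [set x | c <= G x].
have mA : measurable A.
  by rewrite -[X in measurable X]setTI; apply: measurable_fun_le.
have iA : P.-integrable [set: T] (EFin \o (\1_A : T -> R)) by exact: integrable_indic.
have -> : fine (P A) = \int[P]_x (\1_A x : R).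
  by rewrite /Rintegral integral_indic// setIT.
rewrite -RintegralZl//; apply: le_Rintegral => //.
- exact: (integrableZl measurableT _ iA).
- apply: (@bounded_integrable _ _ _ _ _ (expR (`|lambda| * M))).
    by apply: measurableT_comp => //; exact: measurable_funM.
  move=> x; rewrite ger0_norm ?expR_ge0// ler_expR (le_trans (ler_norm _))//.
  exact: normM_le.
move=> x _; rewrite indicE; have [xA|xA] := boolP (x \in A).
  by move: xA; rewrite inE mulr1 ler_expR => xA; exact: ler_wpM2l.
by rewrite mulr0 expR_ge0.
Qed.

Lemma deviation_trunc_mgf (F : T -> R) (lambda W r : R) :
  measurable_fun [set: T] F -> P.-integrable [set: T] (EFin \o F) -> 0 < lambda ->
  (forall N : nat, \int[P]_x expR (lambda * trunc N%:R (F x))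
     <= expR (lambda * \int[P]_x trunc N%:R (F x) + W)) ->
  fine (P [set x | r <= F x - \int[P]_y F y]) <= expR (- (lambda * r) + W).
Proof.
move=> mF iF l0 mgf; set EF := \int[P]_y F y; set A := [set x | _].
have mA : measurable A.
  rewrite -[X in measurable X]setTI; apply: measurable_fun_le => //.
  exact: measurable_funB.
have := fine_ge0 (measure_ge0 P A); rewrite le_eqVlt => /predU1P[<-|p0].
  exact: expR_ge0.
rewrite -[leLHS]lnK ?posrE// ler_expR; apply/ler_addgt0Pr => e e0.
have /cvgrPdist_lt/(_ (e / lambda)) := cvg_Rintegral_trunc mF iF.
rewrite divr_gt0// => /(_ isT) EN.
near \oo => N.
(* With the level [EF + r] below [N], truncation does not push points of [A] below it. The mean of
   the truncation differs from [EF] by less than [e / lambda], a loss of at most [e] in the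
   exponent. *)
have Nc : EF + r <= N%:R by near: N; exact: nbhs_infty_ger.
have NE : `|EF - \int[P]_x trunc N%:R (F x)| < e / lambda by near: N.
rewrite -ler_expR lnK ?posrE//.
have mGN : measurable_fun [set: T] (fun x => trunc N%:R (F x)).
  exact: measurable_trunc.
have GN x : `|trunc N%:R (F x)| <= N%:R by exact: trunc_norm_le.
have := le_trans (exp_markov (EF + r) mGN GN (ltW l0)) (mgf N).
have mB : measurable [set x | EF + r <= trunc N%:R (F x)].
  by rewrite -[X in measurable X]setTI; apply: measurable_fun_le.
have AN : fine (P A) <= fine (P [set x | EF + r <= trunc N%:R (F x)]).
  apply: fine_le; [exact: fin_num_measure|exact: fin_num_measure|].
  apply: le_measure; rewrite ?inE//.
  by move=> x /= h; apply: le_trunc => //; rewrite -lerBrDl.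
move=> /(le_trans (ler_wpM2l (expR_ge0 _) AN)).
rewrite mulrC -ler_pdivlMr ?expR_gt0// -expRN -expRD => /le_trans; apply.
rewrite ler_expR.
have : lambda * (\int[P]_x trunc N%:R (F x) - EF) <= e.
  rewrite mulrC -ler_pdivlMr//; apply: ltW; apply: le_lt_trans NE.
  by rewrite distrC ler_norm.
lra.
Unshelve. all: by end_near. Qed.

End deviation.

(** * The deviation inequality on the product space *)

Lemma local_slopeN (R : realType) (f : R -> R) x :
  local_slope (fun t => - f t) x = local_slope f x.
Proof.
rewrite /local_slope.
rewrite (_ : (fun y => (`|- f x - - f y| / `|x - y|)%:E)
           = fun y => (`|f x - f y| / `|x - y|)%:E)//.
by apply/funext => y; rewrite -opprD normrN.
Qed.

Lemma partial_slopeN (R : realType) n (F : n.-tuple R -> R) i x :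
  partial_slope (fun y => - F y) i x = partial_slope F i x.
Proof. exact: local_slopeN. Qed.

Theorem proposition28 (R : realType) (mu : probability (measurableTypeR R) R)
    (H : R -> \bar R) (kappa : R)
    (H_ge0 : forall x, (0 <= H x)%E)
    (H_even : even_fun H)
    (H_convex : convex_ereal H)
    (H_ratio : forall x y, 0 < x -> x <= y ->
       (H x / (x ^+ 2)%:E <= H y / (y ^+ 2)%:E)%E)
    (H_0 : H 0 = 0%E)
    (kappa_gt0 : 0 < kappa)
    (LSI : log_sobolev_ineq mu H kappa)
    (n : nat) (F : n.-tuple (measurableTypeR R) -> R) (a : R)
    (a_gt0 : 0 < a)
    (F_lip : loc_lipschitz_tuple F)
    (F_grad : {ae prob_power mu n, forall x,
       (\sum_(i < n) H (partial_slope F i x) <= a%:E)%E}) :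
  let K := a * kappa in
  let P := prob_power mu n in
  P.-integrable [set: n.-tuple (measurableTypeR R)] (EFin \o F) /\
  forall r, 0 <= r ->
    (P [set x | (r <= F x - \int[P]_y F y)%R]
       <= expeR (- (K%:E * omega_conj H (2 * r / K)%R)))%E.
Proof.
move=> K P; have K0 : 0 < K by rewrite mulr_gt0.
have mF := measurable_loc_lipschitz_tuple F_lip.
have mgf := mgf_trunc_le H_ge0 H_even H_convex H_ratio H_0 kappa_gt0 LSI.
have iF : P.-integrable [set: n.-tuple (measurableTypeR R)] (EFin \o F).
  have H1 (t : R) : 0 < t -> (H t < +oo)%E -> (H (t * 1)%R <= 1%:E * H t)%E.
    by move=> _ _; rewrite mulr1 mul1e.
  apply: (integrable_trunc_mgf mF (B := a * kappa * 1)) => N.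
    have := mgf n F a 1 1 N%:R F_lip F_grad a_gt0 ltr01 ler01 (ler0n _ _) H1.
    by rewrite mulr1.
  have FN_lip := loc_lipschitz_tupleN F_lip.
  have FN_grad : {ae prob_power mu n, forall x,
      (\sum_(i < n) H (partial_slope (fun y => - F y)%R i x) <= a%:E)%E}.
    have [D [mD D0 sub]] := F_grad; exists D; split => // x /= badH.
    apply: sub => /= Hx; apply: badH.
    by under eq_bigr do rewrite partial_slopeN.
  have := mgf n _ a 1 1 N%:R FN_lip FN_grad a_gt0 ltr01 ler01 (ler0n _ _) H1.
  by rewrite mulr1.
split=> // r r0; set A := [set x | _].
have mA : measurable A.
  rewrite -[X in measurable X]setTI; apply: measurable_fun_le => //.
  exact: measurable_funB.
have PA_fin : P A \is a fin_num by exact: fin_num_measure.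
(* A null event is treated apart: [ln 0 = 0] would make the passage to logarithms meaningless. *)
have := fine_ge0 (measure_ge0 P A); rewrite le_eqVlt => /predU1P[p0|p0].
  by rewrite -(fineK PA_fin) -p0 expeR_ge0.
set p := fine (P A) in p0.
have p1 : p <= 1 by rewrite -lee_fin fineK// probability_le1.
(* In logarithmic form the claim is an upper bound on a supremum, so each [x] is treated separately
   and no optimal [x] need exist. The point [x = 0] only requires [p <= 1], and an infinite
   [omega H x] contributes [-oo]. *)
suff S : (omega_conj H (2 * r / K) <= (- ln p / K)%:E)%E.
  rewrite -(fineK PA_fin) -/p -[leLHS]/(p%:E) -{1}[p]lnK ?posrE//.
  rewrite -[leLHS]/(expeR (ln p)%:E) lee_expeR leeNr.
  apply: (le_trans (lee_wpmul2l _ S)); first by rewrite lee_fin ltW.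
  by rewrite -EFinM lee_fin mulrC divfK// gt_eqF.
apply: ge_ereal_sup => _ [x /= x_ge0 <-]; have [->|xneq0] := eqVneq x 0.
  rewrite mul0r /omega eqxx sube0 lee_fin.
  by apply: divr_ge0; [rewrite oppr_ge0 ln_le0|exact: ltW].
have x0 : 0 < x by rewrite lt0r xneq0.
have [wfin|] := ltP (omega H x) +oo%E; last first.
  by rewrite leye_eq => /eqP ->; rewrite leNye.
have w0 : (0 <= omega H x)%E.
  by rewrite /omega gt_eqF// le_max lexx.
pose w := fine (omega H x).
have Hw (t : R) : 0 < t -> (H t < +oo)%E -> (H (t * x)%R <= w%:E * H t)%E.
  by move=> t0 Ht; exact: cost_le_omega.
have wE : omega H x = w%:E by rewrite fineK// ge0_fin_numE.
have := deviation_trunc_mgf (lambda := 2 * x) (W := K * w) r mF iF.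
rewrite mulr_gt0// => /(_ isT).
have w00 : 0 <= w by exact: fine_ge0.
move=> /(_ (fun N => mgf n F a x w N%:R F_lip F_grad a_gt0 x0 w00 (ler0n _ _) Hw)).
rewrite -/A -/p -{1}[p]lnK ?posrE// ler_expR => h.
rewrite wE -EFinB lee_fin ler_pdivlMr//.
have -> : (x * (2 * r / K) - w) * K = 2 * x * r - K * w by field; rewrite gt_eqF.
lra.
Qed.
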